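(* Suppose (A1) each $f_t(\cdot)=f(\cdot;\boldsymbol\xi_t)$ has $L_g$-Lipschitz continuous gradient and (A2) $\|\nabla f_t(\mathbf x)\|_\infty\le\eta$ for all $\mathbf x$. Run ZO-AdaMM on a closed convex set $\mathcal X$ with $\hat{\mathbf v}_0^{1/2}\ge c\mathbf 1$ ($c>0$), $\alpha_t=\alpha\le c/L_g$, $\mu=1/\sqrt{Td}$ and $\beta_{1,t}=0$, and assume $f_\mu(\mathbf x_1)-\min_{\mathbf x}f_\mu(\mathbf x)\le D_f$. Let $\mathbf x_R$ be picked uniformly at random from $\{\mathbf x_t\}_{t=1}^T$. Then \[ \mathbb E[\|\mathcal G(\mathbf x_R)\|^2]\le\frac{6D_f}{\alpha T}+\frac{3L_g^2d}{4cT}+\frac{6\eta^2}{c^4T}\Big(\max_{t\in[T]}\mathbb E[\|\hat{\mathbf g}_t-\nabla f_\mu(\mathbf x_t)\|^2]+d\eta^2\Big)+\frac{3c+9}{c}\max_{t\in[T]}\mathbb E[\|\hat{\mathbf g}_t-\nabla f_\mu(\mathbf x_t)\|^2]. \]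
   Context: Problem: $\min_{\mathbf x\in\mathcal X}f(\mathbf x)=\mathbb E_{\boldsymbol\xi}[f(\mathbf x;\boldsymbol\xi)]$, $\mathcal X\subseteq\mathbb R^d$ closed convex, $f(\cdot;\boldsymbol\xi)$ differentiable, $\boldsymbol\xi_t$ independent samples. ZO gradient estimate: $\hat\nabla h(\mathbf x)=(d/\mu)[h(\mathbf x+\mu\mathbf u)-h(\mathbf x)]\mathbf u$, $\mathbf u$ uniform on the unit sphere of $\mathbb R^d$, independent across iterations. Smoothed function: $f_\mu(\mathbf x)=\mathbb E_{\mathbf u\sim U_B}[f(\mathbf x+\mu\mathbf u)]$, $U_B$ uniform on the unit Euclidean ball. ZO-AdaMM: given $\mathbf x_1\in\mathcal X$, $\alpha_t$, $\beta_{1,t},\beta_2\in(0,1]$, $\mathbf m_0=\mathbf 0$, $\mathbf v_0=\mathbf 0$, $\hat{\mathbf v}_0$, for $t=1,\dots,T$: $\hat{\mathbf g}_t=\hat\nabla f_t(\mathbf x_t)$; $\mathbf m_t=\beta_{1,t}\mathbf m_{t-1}+(1-\beta_{1,t})\hat{\mathbf g}_t$; $\mathbf v_t=\beta_2\mathbf v_{t-1}+(1-\beta_2)\hat{\mathbf g}_t^2$; $\hat{\mathbf v}_t=\max(\hat{\mathbf v}_{t-1},\mathbf v_t)$, $\hat{\mathbf V}_t=\mathrm{diag}(\hat{\mathbf v}_t)$; $\mathbf x_{t+1}=\Pi_{\mathcal X,\sqrt{\hat{\mathbf V}_t}}(\mathbf x_t-\alpha_t\hat{\mathbf V}_t^{-1/2}\mathbf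 m_t)$, elementwise operations, $\Pi_{\mathcal X,\mathbf H}(\mathbf a)=\arg\min_{\mathbf x\in\mathcal X}\|\sqrt{\mathbf H}(\mathbf x-\mathbf a)\|_2^2$. Gradient mapping: for a positive definite diagonal $\mathbf H$, $\mathbf g\in\mathbb R^d$, $\omega>0$, $\mathbf x^-\in\mathbb R^d$, let $\mathbf x^+=\arg\min_{\mathbf x\in\mathcal X}\{\langle\mathbf g,\mathbf x\rangle+\frac1{2\omega}\|\mathbf H^{1/2}(\mathbf x-\mathbf x^-)\|^2\}$ and $P_{\mathcal X,\mathbf H}(\mathbf x^-,\mathbf g,\omega)=(\mathbf x^--\mathbf x^+)/\omega$. Convergence measure: $\|\mathcal G(\mathbf x_t)\|^2:=\|\hat{\mathbf V}_t^{1/4}P_{\mathcal X,\hat{\mathbf V}_t^{1/2}}(\mathbf x_t,\nabla f(\mathbf x_t),\alpha_t)\|^2$. $\|\cdot\|$ is the Euclidean norm; expectations are over all randomness. *)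

(* Defs.v *)
From HB Require Import structures.
From mathcomp Require Import all_boot all_order all_algebra.
From mathcomp Require Import all_classical all_reals all_analysis.

Set Implicit Arguments.
Unset Strict Implicit.
Unset Printing Implicit Defensive.

Import Order.TTheory GRing.Theory Num.Theory.
Import numFieldNormedType.Exports.

Local Open Scope classical_set_scope.
Local Open Scope ring_scope.

(* Borel sigma-algebra on R^d = 'rV[R]_d: generated by the coordinate  *)
(* projections (product Borel sigma-algebra = Borel sets of R^d).      *)

Definition rV_measure_display : measure_display.
Proof. exact: default_measure_display. Qed.

Section measurable_rV.
Context {R : realType} (n : nat).

Let coors : 'I_n -> 'rV[R]_n -> R := fun i x => x ord0 i.

Let rV_set0 : g_sigma_preimage coors set0.
Proof. exact: sigma_algebra0. Qed.

Let rV_setC A : g_sigma_preimage coors A -> g_sigma_preimage coors (~` A).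
Proof. exact: sigma_algebraC. Qed.

Let rV_bigcup (F : _^nat) : (forall i, g_sigma_preimage coors (F i)) ->
  g_sigma_preimage coors (\bigcup_i (F i)).
Proof. exact: sigma_algebra_bigcup. Qed.

HB.instance Definition _ := @isMeasurable.Build
  rV_measure_display 'rV[R]_n
  (g_sigma_preimage coors) rV_set0 rV_setC rV_bigcup.

End measurable_rV.

Section vec_ops.
Context {R : realType} {d : nat}.
Implicit Types (u v : 'rV[R]_d).

Definition enorm u : R := Num.sqrt (\sum_(i < d) u ord0 i ^+ 2).
Definition dotv u v : R := \sum_(i < d) u ord0 i * v ord0 i.
Definition emul u v : 'rV[R]_d := \row_i (u ord0 i * v ord0 i).
Definition esqrt u : 'rV[R]_d := \row_i Num.sqrt (u ord0 i).
Definition ediv u v : 'rV[R]_d := \row_i (u ord0 i / v ord0 i).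
Definition emax u v : 'rV[R]_d := \row_i Num.max (u ord0 i) (v ord0 i).

Definition grad (phi : 'rV[R]_d -> R) (x : 'rV[R]_d) : 'rV[R]_d :=
  \row_i ('D_(delta_mx ord0 i) phi x).

Definition convex_vset (X : set 'rV[R]_d) : Prop :=
  forall x y (t : R), X x -> X y -> 0 <= t <= 1 -> X (t *: x + (1 - t) *: y).

(* Pi_{X,H}(a) = argmin_{x in X} || sqrt(H) (x - a) ||^2, H = diag(h) *)
Definition wproj (X : set 'rV[R]_d) (h a : 'rV[R]_d) : 'rV[R]_d :=
  xget 0 [set z | X z /\ forall y, X y ->
     enorm (emul (esqrt h) (z - a)) ^+ 2 <= enorm (emul (esqrt h) (y - a)) ^+ 2].

Definition gm_xplus (X : set 'rV[R]_d) (h xm g : 'rV[R]_d) (om : R) : 'rV[R]_d :=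
  xget 0 [set z | X z /\ forall y, X y ->
     dotv g z + (2 * om)^-1 * enorm (emul (esqrt h) (z - xm)) ^+ 2 <=
     dotv g y + (2 * om)^-1 * enorm (emul (esqrt h) (y - xm)) ^+ 2].

Definition gmap (X : set 'rV[R]_d) (h xm g : 'rV[R]_d) (om : R) : 'rV[R]_d :=
  om^-1 *: (xm - gm_xplus X h xm g om).

Definition unit_ball : set 'rV[R]_d := [set w | enorm w <= 1].

Definition sphere_cone (A : set 'rV[R]_d) : set 'rV[R]_d :=
  [set w | 0 < enorm w <= 1 /\ A ((enorm w)^-1 *: w)].

End vec_ops.

(* Lebesgue measure on R^d, characterized by its value on boxes        *)
(* (which determines it uniquely on the Borel sets).                   *)
Definition is_lebesgue_rV {R : realType} {d : nat}
    (lam : {measure set 'rV[R]_d -> \bar R}) : Prop :=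
  forall a b : 'rV[R]_d, (forall i, a ord0 i <= b ord0 i) ->
    lam [set x | forall i, a ord0 i <= x ord0 i <= b ord0 i] =
    (\prod_(i < d) (b ord0 i - a ord0 i))%:E.

(* U is uniformly distributed on the unit sphere S^{d-1}: the law of U is
   the normalized surface measure, sigma(A) = lam(cone A) / lam(unit ball)
   (cone-measure formula for the surface measure of the sphere). *)
Definition uniform_sphere_rv {R : realType} {d : nat}
    {dO} {Omega : measurableType dO} (P : probability Omega R)
    (lam : {measure set 'rV[R]_d -> \bar R}) (U : Omega -> 'rV[R]_d) : Prop :=
  forall A : set 'rV[R]_d, measurable A ->
    P (U @^-1` A) = (fine (lam (sphere_cone A)) / fine (lam unit_ball))%:E.

Definition mutual_indep {R : realType} {dO} {Omega : measurableType dO}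
    (P : probability Omega R) {dT} {Ty : measurableType dT} (n : nat)
    (Y : 'I_n -> Omega -> Ty) : Prop :=
  forall A : 'I_n -> set Ty, (forall i, measurable (A i)) ->
    P (\bigcap_(i in [set: 'I_n]) (Y i @^-1` A i)) =
    (\prod_(i < n) P (Y i @^-1` A i))%E.

Definition indep2 {R : realType} {dO} {Omega : measurableType dO}
    (P : probability Omega R) {d1 d2} {T1 : measurableType d1}
    {T2 : measurableType d2} (Y1 : Omega -> T1) (Y2 : Omega -> T2) : Prop :=
  forall A B, measurable A -> measurable B ->
    P (Y1 @^-1` A `&` Y2 @^-1` B) = (P (Y1 @^-1` A) * P (Y2 @^-1` B))%E.

(* Main.v *)
(* Put h = sqrt (vhat_t) >= c, g = grad fmu (x_t),
   delta = ghat_t - g, and J_b y = <b, y> + |y - x_t|_h^2 / (2 alpha) with the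
   norm weighted by h, so that x_{t+1} minimizes J_ghat on X; let q minimize
   J_g on X. Since fmu is Lg-smooth and alpha Lg <= c,
   fmu x_{t+1} <= fmu x_t + J_g x_{t+1} - <g, x_t>. Strong convexity of J_ghat
   followed by Young's inequality for <delta, q - x_{t+1}> gives
   J_g x_{t+1} <= J_g q + alpha |delta|^2 / (2 c), and strong convexity of J_g
   gives J_g q <= <g, x_t> - |x_t - q|_h^2 / (2 alpha). Hence the gradient
   mapping of g at x_t has squared weighted norm at most
   (2 / alpha) (fmu x_t - fmu x_{t+1}) + |delta|^2 / c. Replacing g by grad f
   costs at most |g - grad f|_2 / sqrt c, where
   |g - grad f|_2 <= mu Lg E|w| for w uniform on the unit ball. Telescoping over
   t and taking expectations yields the bound with room to spare. *)

Require Import Defs.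
From HB Require Import structures.
From mathcomp Require Import all_boot all_order all_algebra.
From mathcomp Require Import all_classical all_reals all_analysis.
From mathcomp Require Import measurable_realfun ring lra.

Import Order.TTheory GRing.Theory Num.Theory.
Import numFieldNormedType.Exports.

Local Open Scope classical_set_scope.
Local Open Scope ring_scope.

(** * Weighted norms and proximal steps *)

Section Vectors.
Context {R : realType} {d : nat}.
Implicit Types (h a b u v x y z g p : 'rV[R]_d) (X : set 'rV[R]_d).

Lemma enorm_ge0 u : 0 <= enorm u.
Proof. exact: sqrtr_ge0. Qed.

Lemma sqr_enorm u : enorm u ^+ 2 = \sum_(i < d) u ord0 i ^+ 2.
Proof. by rewrite sqr_sqrtr// sumr_ge0// => i _; rewrite sqr_ge0. Qed.

Lemma enormN u : enorm (- u) = enorm u.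
Proof. by congr Num.sqrt; apply: eq_bigr => i _; rewrite mxE sqrrN. Qed.

Lemma enormZ (r : R) u : enorm (r *: u) = `|r| * enorm u.
Proof.
rewrite -sqrtr_sqr /enorm -sqrtrM ?sqr_ge0//; congr Num.sqrt.
by rewrite mulr_sumr; apply: eq_bigr => i _; rewrite mxE exprMn.
Qed.

Lemma dotvC u v : dotv u v = dotv v u.
Proof. by apply: eq_bigr => i _; rewrite mulrC. Qed.

Lemma dotvDl u v p : dotv (u + v) p = dotv u p + dotv v p.
Proof. by rewrite -big_split; apply: eq_bigr => i _; rewrite mxE mulrDl. Qed.

Lemma dotvNl u p : dotv (- u) p = - dotv u p.
Proof. by rewrite -sumrN; apply: eq_bigr => i _; rewrite mxE mulNr. Qed.

Lemma dotvBl u v p : dotv (u - v) p = dotv u p - dotv v p.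
Proof. by rewrite dotvDl dotvNl. Qed.

Lemma dotvZl (r : R) u p : dotv (r *: u) p = r * dotv u p.
Proof. by rewrite mulr_sumr; apply: eq_bigr => i _; rewrite mxE mulrA. Qed.

Lemma dotvDr u v p : dotv p (u + v) = dotv p u + dotv p v.
Proof. by rewrite dotvC dotvDl !(dotvC p). Qed.

Lemma dotvBr u v p : dotv p (u - v) = dotv p u - dotv p v.
Proof. by rewrite dotvC dotvBl !(dotvC p). Qed.

Lemma dotvZr (r : R) u p : dotv p (r *: u) = r * dotv p u.
Proof. by rewrite dotvC dotvZl dotvC. Qed.

Lemma dotv_delta g i : dotv g (delta_mx ord0 i) = g ord0 i.
Proof.
rewrite /dotv (bigD1 i)//= mxE !eqxx mulr1 big1 ?addr0// => j ji.
by rewrite mxE (negbTE ji) andbF mulr0.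
Qed.

Lemma enorm_delta i : enorm (delta_mx ord0 i : 'rV[R]_d) = 1.
Proof.
apply/eqP; rewrite -(@eqrXn2 _ 2) ?enorm_ge0// sqr_enorm expr1n.
rewrite (bigD1 i)//= mxE !eqxx expr1n big1 ?addr0// => j ji.
by rewrite mxE (negbTE ji) andbF expr0n.
Qed.

Lemma dotv0l u : dotv 0 u = 0.
Proof. by rewrite /dotv big1// => i _; rewrite mxE mul0r. Qed.

Lemma enorm0_eq0 u : enorm u = 0 -> u = 0.
Proof.
move=> u0; apply/rowP => i; rewrite mxE.
move: (sqr_enorm u); rewrite u0 expr0n/= => /esym/eqP.
rewrite psumr_eq0 => [/allP/(_ i)|? _]; last by rewrite sqr_ge0.
by rewrite mem_index_enum/= => /(_ isT); rewrite sqrf_eq0 => /eqP.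
Qed.

(** Cauchy-Schwarz: sum the squares [(t * u_i - s * v_i) ^+ 2], take [s = enorm u] and
    [t = enorm v], and divide by [2 * s * t]; a zero norm is treated apart. *)
Lemma dotv_le_enorm u v : dotv u v <= enorm u * enorm v.
Proof.
have H : forall s t : R, 0 < s -> 0 < t ->
    2 * s * t * dotv u v <= t ^+ 2 * enorm u ^+ 2 + s ^+ 2 * enorm v ^+ 2.
  move=> s t s0 t0; rewrite !sqr_enorm !mulr_sumr -big_split/=.
  apply: ler_sum => i _; rewrite -subr_ge0.
  rewrite (_ : _ - _ = (t * u ord0 i - s * v ord0 i) ^+ 2) ?sqr_ge0//.
  by ring.
have [/enorm0_eq0 ->|u0] := eqVneq (enorm u) 0.
  by rewrite dotv0l mulr_ge0 ?enorm_ge0.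
have [/enorm0_eq0 ->|v0] := eqVneq (enorm v) 0.
  by rewrite dotvC dotv0l mulr_ge0 ?enorm_ge0.
have {}u0 : 0 < enorm u by rewrite lt_def u0 enorm_ge0.
have {}v0 : 0 < enorm v by rewrite lt_def v0 enorm_ge0.
have Huv := H _ _ u0 v0.
have p0 : 0 < 2 * enorm u * enorm v by rewrite !mulr_gt0.
rewrite -(ler_pM2l p0); apply: (le_trans Huv).
by rewrite le_eqVlt; apply/orP; left; apply/eqP; ring.
Qed.

Lemma normr_dotv_le u v : `|dotv u v| <= enorm u * enorm v.
Proof.
rewrite ler_norml dotv_le_enorm andbT -(enormN u) lerNl -dotvNl.
exact: dotv_le_enorm.
Qed.

Lemma dotvv u : dotv u u = enorm u ^+ 2.
Proof. by rewrite sqr_enorm. Qed.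

Lemma ler_enormD u v : enorm (u + v) <= enorm u + enorm v.
Proof.
rewrite -(@ler_pXn2r _ 2) ?nnegrE ?addr_ge0 ?enorm_ge0//.
rewrite -dotvv dotvDl !dotvDr !dotvv (dotvC v u) sqrrD.
by have := dotv_le_enorm u v; lra.
Qed.

Lemma coord_le_enorm u i : `|u ord0 i| <= enorm u.
Proof.
by rewrite -dotv_delta (le_trans (normr_dotv_le _ _))// enorm_delta mulr1.
Qed.

Lemma norm_le_enorm u : `|u| <= enorm u.
Proof.
rewrite [leLHS]/Num.norm/= mx_normrE; apply: bigmax_le => [|[j i] _]/=.
  exact: enorm_ge0.
by rewrite ord1 coord_le_enorm.
Qed.

(** Squared norm with weights [h]. Keeping the weights linear, free of square roots, turns later
    identities into coordinatewise ring identities. *)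
Definition wsq h u : R := \sum_(i < d) h ord0 i * u ord0 i ^+ 2.

Lemma sqr_enorm_esqrt h u : (forall i, 0 <= h ord0 i) ->
  enorm (emul (esqrt h) u) ^+ 2 = wsq h u.
Proof.
move=> h0; rewrite sqr_enorm; apply: eq_bigr => i _.
by rewrite !mxE exprMn sqr_sqrtr.
Qed.

Lemma wsq_ge0 h u : (forall i, 0 <= h ord0 i) -> 0 <= wsq h u.
Proof. by move=> h0; rewrite sumr_ge0// => i _; rewrite mulr_ge0 ?sqr_ge0. Qed.

Lemma wsq_ge h u (c : R) : (forall i, c <= h ord0 i) ->
  c * enorm u ^+ 2 <= wsq h u.
Proof.
move=> hc; rewrite sqr_enorm mulr_sumr; apply: ler_sum => i _.
by rewrite ler_wpM2r ?sqr_ge0.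
Qed.

Lemma wsqB h x y : wsq h (x - y) = wsq h (y - x).
Proof. by apply: eq_bigr => i _; rewrite !mxE -sqrrN opprB. Qed.

Lemma wsqZ h (r : R) u : wsq h (r *: u) = r ^+ 2 * wsq h u.
Proof. by rewrite mulr_sumr; apply: eq_bigr => i _; rewrite mxE; ring. Qed.

(** Complete the square in each coordinate with the weight [h_i]; only the term in [b] is then
    relaxed from [h_i] to its lower bound [c]. *)
Lemma dotv_le_young h b u (c k : R) : 0 < c -> 0 < k ->
  (forall i, c <= h ord0 i) ->
  dotv b u <= (4 * k * c)^-1 * enorm b ^+ 2 + k * wsq h u.
Proof.
move=> c0 k0 hc; rewrite sqr_enorm !mulr_sumr -big_split/=.
apply: ler_sum => i _.
have h0 : 0 < h ord0 i by apply: lt_le_trans (hc i).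
have kc0 : 0 < 4 * k * c by rewrite !mulr_gt0.
apply: (@le_trans _ _ ((4 * k * h ord0 i)^-1 * b ord0 i ^+ 2 +
    k * (h ord0 i * u ord0 i ^+ 2))); last first.
  rewrite lerD2r ler_wpM2r ?sqr_ge0// lef_pV2 ?posrE ?mulr_gt0//.
  by rewrite ler_pM2l ?mulr_gt0.
rewrite -subr_ge0 (_ : _ - _ = (4 * k * h ord0 i)^-1 *
   (b ord0 i - 2 * k * h ord0 i * u ord0 i) ^+ 2); last first.
  by field; rewrite !gt_eqF.
by rewrite mulr_ge0 ?sqr_ge0// invr_ge0 !mulr_ge0// ltW.
Qed.

(** One objective for both minimizations: [g = 0], [k = 1] is that of [wproj], and [k = (2 * al)^-1]
    is that of [gm_xplus]. *)
Definition prox_obj h x g (k : R) y : R := dotv g y + k * wsq h (y - x).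

Definition minimizers X (J : 'rV[R]_d -> R) : set 'rV[R]_d :=
  [set z | X z /\ forall y, X y -> J z <= J y].

(** Quadratic growth at a constrained minimizer. Along the segment from [z] to [y] the objective is
    exactly quadratic, so minimality at [t *: y + (1 - t) *: z], divided by [t], gives the claim
    with an extra factor [1 - t]. *)
Lemma prox_ineq X h x g (k : R) z y : convex_vset X -> 0 <= k ->
  (forall i, 0 <= h ord0 i) -> minimizers X (prox_obj h x g k) z -> X y ->
  prox_obj h x g k z + k * wsq h (y - z) <= prox_obj h x g k y.
Proof.
move=> cX k0 h0 [Xz zmin] Xy; set J := prox_obj h x g k.
have W0 := wsq_ge0 _ (y - z) h0.
have key t : 0 < t <= 1 -> (1 - t) * (k * wsq h (y - z)) <= J y - J z.
  move=> /andP[t0 t1]; have := zmin _ (cX _ _ t Xy Xz _).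
  rewrite (ltW t0) t1 => /(_ isT); rewrite -/J.
  have -> : J (t *: y + (1 - t) *: z) =
      t * J y + (1 - t) * J z - t * ((1 - t) * (k * wsq h (y - z))).
    rewrite /J /prox_obj /dotv /wsq !mulr_sumr -!big_split/= !mulr_sumr.
    rewrite -big_split/= -sumrB; apply: eq_bigr => i _.
    by rewrite !mxE; ring.
  by move=> Jz; rewrite -(ler_pM2l t0); lra.
rewrite -lerBrDl leNgt; apply/negP => lt.
set D := J y - J z in key lt *; set B := k * wsq h (y - z) in key lt.
have D0 : 0 <= D by rewrite subr_ge0 zmin.
have B0 : 0 < B := le_lt_trans D0 lt.
(* In place of a limit [t -> 0]: if [D < B], this [t] gives [(1 - t) * B = (B + D) / 2 > D], a
   contradiction. *)
have := key ((B - D) / (2 * B)).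
have -> : 0 < (B - D) / (2 * B) <= 1.
  have B20 : 0 < 2 * B by lra.
  apply/andP; split; first by rewrite divr_gt0// subr_gt0.
  by rewrite ler_pdivrMr// mul1r; lra.
have -> : (1 - (B - D) / (2 * B)) * B = (B + D) / 2 by field; rewrite gt_eqF.
by move=> /(_ isT); lra.
Qed.

Lemma gm_xplus_minimizers X h x g (al : R) : (forall i, 0 <= h ord0 i) ->
  gm_xplus X h x g al = xget 0 (minimizers X (prox_obj h x g (2 * al)^-1)).
Proof.
move=> h0; rewrite /gm_xplus /minimizers /prox_obj; congr xget.
apply/seteqP; split=> z /= [Xz zmin]; split=> // y /zmin.
  by rewrite !sqr_enorm_esqrt.
by rewrite !sqr_enorm_esqrt.
Qed.

Lemma wproj_minimizers X h a : (forall i, 0 <= h ord0 i) ->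
  wproj X h a = xget 0 (minimizers X (prox_obj h a 0 1)).
Proof.
move=> h0; rewrite /wproj /minimizers /prox_obj; congr xget.
apply/seteqP; split=> z /= [Xz zmin]; split=> // y /zmin.
  by rewrite !sqr_enorm_esqrt// !dotv0l !add0r !mul1r.
by rewrite !sqr_enorm_esqrt// !dotv0l !add0r !mul1r.
Qed.

(** The remainder is free of [y], so projecting the scaled gradient step and minimizing the
    linearized proximal objective have the same solutions. *)
Lemma prox_obj_complete_square h x g (al : R) y : 0 < al ->
  (forall i, 0 < h ord0 i) ->
  prox_obj h (x - al *: ediv g h) 0 1 y =
    2 * al * prox_obj h x g (2 * al)^-1 y
    + \sum_(i < d) (al ^+ 2 * g ord0 i ^+ 2 / h ord0 i -
                    2 * al * g ord0 i * x ord0 i).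
Proof.
move=> a0 h0; rewrite /prox_obj /dotv /wsq !mulr_sumr -!big_split/= !mulr_sumr.
rewrite -big_split/=; apply: eq_bigr => i _.
by rewrite !mxE; field; rewrite !gt_eqF.
Qed.

(** Identifies the update of the method with the point defining the gradient mapping. Both sides
    apply [xget] to the same set, so they agree whatever point it chooses. *)
Lemma wproj_gm_xplus X h x g (al : R) : 0 < al -> (forall i, 0 < h ord0 i) ->
  wproj X h (x - al *: ediv g h) = gm_xplus X h x g al.
Proof.
move=> a0 h0; rewrite wproj_minimizers ?gm_xplus_minimizers//; last 2 first.
- by move=> i; exact: ltW.
- by move=> i; exact: ltW.
congr xget; apply: eq_set => z; congr (_ /\ _).
have a20 : 0 < 2 * al by rewrite mulr_gt0.
by apply: eq_forall => y; rewrite !prox_obj_complete_square// lerD2r ler_pM2l.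
Qed.

Lemma cvg_sum_ord (T : Type) (F : set_system T) (n : nat) (f : 'I_n -> T -> R)
    (l : 'I_n -> R) : Filter F ->
  (forall i, f i t @[t --> F] --> l i) ->
  \sum_(i < n) f i t @[t --> F] --> \sum_(i < n) l i.
Proof.
move=> FF fl; apply: cvg_big => [|i _]; last exact: fl.
by move=> x; apply: cvgD; [exact: cvg_fst|exact: cvg_snd].
Qed.

Lemma wsq_continuous h a : continuous (fun y => wsq h (y - a)).
Proof.
have -> : (fun y => wsq h (y - a)) =
    (fun y => \sum_(i < d) h ord0 i * (y ord0 i - a ord0 i) ^+ 2).
  by apply/funext => y; apply: eq_bigr => i _; rewrite !mxE.
move=> y; apply: (@cvg_sum_ord _ (nbhs y)) => i.
apply: cvgM; first exact: cvg_cst.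
have cy : (fun z : 'rV[R]_d => z ord0 i - a ord0 i) @ y -->
    y ord0 i - a ord0 i.
  apply: (@cvgB _ _ _ (nbhs y) _ (fun z : 'rV[R]_d => z ord0 i) (fun=> a ord0
    i)); last exact: cvg_cst.
  exact: (@coord_continuous R 1 d ord0 i y).
exact: (cvg_comp _ _ cy (@exprn_continuous _ 2 _)).
Qed.

(** Weights at least [c > 0] make the objective coercive, so its sublevel set in [X] through a point
    of [X] is compact and the extreme value theorem applies. *)
Lemma wproj_minimizes X h a (c : R) : closed X -> X !=set0 -> 0 < c ->
  (forall i, c <= h ord0 i) ->
  minimizers X (prox_obj h a 0 1) (wproj X h a).
Proof.
move=> clX [x Xx] c0 hc.
have h0 i : 0 <= h ord0 i by apply: le_trans (hc i); exact: ltW.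
rewrite wproj_minimizers//; apply: xgetPex.
set q := fun y => wsq h (y - a).
have Jq y : prox_obj h a 0 1 y = q y.
  by rewrite /prox_obj mul1r dotv0l add0r.
have cq : continuous q := wsq_continuous h a.
pose A := X `&` q @^-1` [set r | r <= q x].
have clA : closed A.
  apply: closedI => //; apply: closed_comp; last exact: closed_le.
  by move=> y _; exact: cq.
have [] := @EVT_min_rV R d q A.
- by exists x; split => //=.
- apply: bounded_closed_compact => //.
  (* With [r = enorm (y - a)], the sublevel condition gives [r ^+ 2 <= q x / c], and
     [r <= r ^+ 2 + 1] follows from [0 <= (r - 1) ^+ 2]. *)
  exists (`|a| + (q x / c + 1)); split; first exact: num_real.
  move=> M ltM y [Xy /= qy]; apply: ltW; apply: le_lt_trans ltM.
  rewrite -[y](subrK a) (le_trans (ler_normD _ _))// addrC lerD2l.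
  rewrite (le_trans (norm_le_enorm _))//.
  have : enorm (y - a) ^+ 2 <= q x / c.
    rewrite ler_pdivlMr// mulrC; apply: le_trans qy.
    exact: wsq_ge.
  have := sqr_ge0 (enorm (y - a) - 1); rewrite sqrrB !expr1n mulr1.
  by have := enorm_ge0 (y - a); lra.
- exact: continuous_subspaceT.
move=> z; rewrite inE => -[Xz zx] zmin; exists z; split=> // y Xy.
rewrite !Jq; have [qyx|qyx] := leP (q y) (q x).
  by apply: zmin; rewrite inE.
by rewrite (le_trans zx)// ltW.
Qed.

Lemma gm_xplus_minimizes X h x g (al c : R) : closed X -> X !=set0 ->
  0 < al -> 0 < c -> (forall i, c <= h ord0 i) ->
  minimizers X (prox_obj h x g (2 * al)^-1) (gm_xplus X h x g al).
Proof.
move=> clX X0 a0 c0 hc.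
have h0 i : 0 < h ord0 i by apply: lt_le_trans (hc i).
have := wproj_minimizes X h (x - al *: ediv g h) c clX X0 c0 hc.
rewrite wproj_gm_xplus// => -[Xz zmin]; split=> // y Xy.
have := zmin y Xy.
have a20 : 0 < 2 * al by rewrite mulr_gt0.
by rewrite !prox_obj_complete_square// lerD2r ler_pM2l.
Qed.

End Vectors.

(** * Smooth functions *)

Section Smooth.
Context {R : realType} {d : nat}.
Implicit Types (g : 'rV[R]_d -> 'rV[R]_d) (phi : 'rV[R]_d -> R).

(** The descent inequality in two-sided form. It is stable under averaging of [phi] and [g], and
    [smooth_grad] recovers the gradient from it, which avoids differentiating under an integral. *)
Definition smooth_with (L : R) phi g : Prop := forall y h,
  `|phi (y + h) - phi y - dotv (g y) h| <= L / 2 * enorm h ^+ 2.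

(** The mean value theorem is applied on the segment from [y] to [y + h]; the sign [e] treats both
    halves of the absolute value at once. *)
Lemma differentiable_smooth (L : R) phi :
  (forall y, differentiable phi y) ->
  (forall y z, enorm (grad phi y - grad phi z) <= L * enorm (y - z)) ->
  smooth_with L phi (grad phi).
Proof.
move=> dphi Lip y h.
have dirE z : 'D_h phi z = dotv (grad phi z) h.
  rewrite deriveE//.
  have hE : h = \sum_(i < d) h ord0 i *: delta_mx ord0 i := row_sum_delta h.
  rewrite [in LHS]hE linear_sum; apply: eq_bigr => i _.
  by rewrite linearZ/= -deriveE// mxE [RHS]mulrC.
have der (t : R) : is_derive t 1 (fun s : R => phi (y + s *: h))
    (dotv (grad phi (y + t *: h)) h).
  rewrite -dirE; have dphit : derivable phi (y + t *: h) h.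
    exact: diff_derivable.
  have E : (fun s : R => s^-1 *: (((fun s : R => phi (y + s *: h)) \o shift t)
        (s *: (1 : R)) - phi (y + t *: h))) =
      (fun s : R => s^-1 *: ((phi \o shift (y + t *: h)) (s *: h) -
        phi (y + t *: h))).
    apply/funext => s /=; congr (_ *: (phi _ - _)).
    by rewrite /shift/= scalerDl [s *: 1]mulr1 addrCA.
  by split; rewrite /derivable /derive E.
have bnd (e : R) : e = 1 \/ e = - 1 ->
    e * (phi (y + h) - phi y - dotv (grad phi y) h) <= L / 2 * enorm h ^+ 2.
  move=> eE.
  pose p (s : R) := phi (y + s *: h).
  pose a := dotv (grad phi y) h; pose b := L / 2 * enorm h ^+ 2.
  (* The term [b * s ^+ 2] is chosen so that its derivative [2 * b * t] is the Lipschitz bound on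
     the change of the directional derivative; hence [k] has nonpositive slope at the mean value
     point. *)
  pose k : R -> R := (e \*: (p - a \*: id)) - b \*: (id ^+ 2).
  pose dk (t : R) := e * (dotv (grad phi (y + t *: h)) h - a) - b * (2 * t).
  have dk_ (t : R) : is_derive t (1 : R) k (dk t).
    rewrite /k; have dp := der t; apply: is_derive_eq.
    by rewrite /dk /GRing.scale/= expr1 !mulr1.
  have ck : {within `[0, 1], continuous k}.
    apply: continuous_subspaceT => t.
    by apply: differentiable_continuous; apply/derivable1_diffP; case: (dk_ t).
  have [t] := MVT ltr01 (fun t _ => dk_ t) ck.
  rewrite in_itv/= => /andP[t0 t1].
  have kE s : k s = e * (phi (y + s *: h) - a * s) - b * s ^+ 2 by [].
  rewrite !kE scale1r scale0r addr0 expr1n expr0n/= !mulr0 !subr0 !mulr1 {kE}.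
  move=> kE.
  suff dk0 : dk t <= 0 by move: dk0; rewrite -kE /a /b; lra.
  rewrite /dk -dotvBl subr_le0.
  apply: (@le_trans _ _ `|dotv (grad phi (y + t *: h) - grad phi y) h|).
    case: eE => ->; first by rewrite mul1r ler_norm.
    by rewrite mulN1r -normrN ler_norm.
  apply: (le_trans (normr_dotv_le _ _)).
  apply: (@le_trans _ _ (L * enorm (t *: h) * enorm h)).
    rewrite ler_wpM2r ?enorm_ge0// (le_trans (Lip _ _))//.
    by rewrite addrC addKr.
  rewrite enormZ gtr0_norm// /b le_eqVlt; apply/orP; left; apply/eqP; by field.
have b1 := bnd 1 (or_introl erefl); have b2 := bnd (-1) (or_intror erefl).
by rewrite ler_norml; move: b1 b2; lra.
Qed.

(** A difference quotient of step [t] along a unit coordinate vector misses the coordinate of [g] by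
    at most [L / 2 * |t|]. *)
Lemma smooth_grad (L : R) phi g : smooth_with L phi g -> grad phi = g.
Proof.
move=> sphi; apply/funext => y; apply/rowP => i; rewrite mxE.
apply: cvg_lim => //.
apply/cvgrPdist_le => /= e e0.
have L0 : 0 <= L.
  have := sphi 0 (delta_mx ord0 i); rewrite enorm_delta expr1n mulr1.
  by move=> /(le_trans (normr_ge0 _)); lra.
near=> t.
have t0 : t != 0 by near: t; exact: nbhs_dnbhs_neq.
rewrite /= distrC [_ + y]addrC.
have := sphi y (t *: delta_mx ord0 i).
rewrite enormZ enorm_delta mulr1 dotvZr dotv_delta.
set D := phi (y + _) - _ => Db.
have -> : t^-1 *: D - g y ord0 i = t^-1 * (D - t * g y ord0 i).
  by rewrite mulrBr mulKf.
rewrite normrM normfV ler_pdivrMl ?normr_gt0// (le_trans Db)//.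
rewrite expr2 mulrCA ler_wpM2l//.
(* Dividing by [L + 1] instead of [L] also covers [L = 0]. *)
apply: (@le_trans _ _ (L / 2 * (e / (L + 1)))).
  rewrite ler_wpM2l ?divr_ge0//; near: t; apply: dnbhs0_le.
  by rewrite divr_gt0// ltr_wpDl.
rewrite mulrA ler_pdivrMr ?ltr_wpDl// mulrC ler_wpM2l ?(ltW e0)//; lra.
Unshelve. all: by end_near. Qed.

End Smooth.

(** * Measurability in the space of row vectors *)

Section Measurability.
Context {R : realType} {d : nat}.

Lemma measurable_coord (i : 'I_d) :
  measurable_fun [set: 'rV[R]_d] (fun y => y ord0 i).
Proof.
move=> _ A mA; rewrite setTI; apply: sub_sigma_algebra => /=.
rewrite -bigcup_seq/=; exists i => /=; first by rewrite mem_index_enum.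
by exists A => //; rewrite setTI.
Qed.

Lemma measurable_fun_rVP {dO} {Omega : measurableType dO}
    (Y : Omega -> 'rV[R]_d) :
  measurable_fun setT Y <->
  forall i, measurable_fun setT (fun w => Y w ord0 i).
Proof.
split=> [mY i|mY].
  exact: (measurableT_comp (measurable_coord i) mY).
apply: measurability => //.
move=> _ [A GA <-].
move: GA; rewrite -bigcup_seq/= => -[i _ [B mB <-]].
by have := mY i measurableT B mB; rewrite !setTI.
Qed.

(** Sequential continuity, with convergence taken coordinatewise: this is the form that pointwise
    limits of measurable functions and [cvg_grid] use directly. *)
Definition ccont (phi : 'rV[R]_d -> R) : Prop :=
  forall (s : nat -> 'rV[R]_d) (y : 'rV[R]_d),
  (forall i, s n ord0 i @[n --> \oo] --> y ord0 i) ->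
  phi (s n) @[n --> \oo] --> phi y.

Definition grid (n : nat) (k : 'rV[int]_d) : 'rV[R]_d :=
  \row_i ((k ord0 i)%:~R / n.+1%:R).

Definition gridpt (n : nat) (y : 'rV[R]_d) : 'rV[int]_d :=
  \row_i Num.floor (n.+1%:R * y ord0 i).

Lemma cvg_grid (y : 'rV[R]_d) i :
  grid n (gridpt n y) ord0 i @[n --> \oo] --> y ord0 i.
Proof.
apply: (@squeeze_cvgr _ _ _ _ (fun n => y ord0 i - n.+1%:R^-1)
  (cst (y ord0 i))).
- near=> n; rewrite !mxE /=.
  have n0 : (0 : R) < n.+1%:R by [].
  have /andP[] := real_floor_itv (num_real (n.+1%:R * y ord0 i)).
  rewrite intrD => f1 f2; apply/andP; split.
    by rewrite ler_pdivlMr// mulrBl mulVf ?gt_eqF// lerBlDr [leLHS]mulrC ltW.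
  by rewrite ler_pdivrMr// [leRHS]mulrC.
- rewrite -[X in _ --> X]subr0; apply: cvgB; first exact: cvg_cst.
  exact: cvg_harmonic.
- exact: cvg_cst.
Unshelve. all: by end_near. Qed.

Lemma measurable_gridpt {dO} {Omega : measurableType dO} (Y : Omega -> 'rV[R]_d)
    n k : measurable_fun setT Y -> measurable [set w | gridpt n (Y w) = k].
Proof.
move=> /measurable_fun_rVP mY.
have -> : [set w | gridpt n (Y w) = k] = \bigcap_(i in [set: 'I_d])
    [set w | Num.floor (n.+1%:R * Y w ord0 i) = k ord0 i].
  apply/seteqP; split=> [w /= <- i _/=|w /= H]; first by rewrite mxE.
  by apply/rowP => i; rewrite mxE; exact: H.
apply: fin_bigcap_measurable => // i _.
have -> : [set w | Num.floor (n.+1%:R * Y w ord0 i) = k ord0 i] =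
    (fun w => n.+1%:R * Y w ord0 i) @^-1`
      `[(k ord0 i)%:~R, (k ord0 i + 1)%:~R[%classic.
  apply/seteqP; split=> w /=; rewrite in_itv/=.
    by move=> <-; exact: real_floor_itv (num_real _).
  exact: floor_def.
by rewrite -[_ @^-1` _]setTI; apply: measurable_funM => //.
Qed.

(* Rounding [Y] to the grid of mesh [1 / n.+1] makes it countably valued. *)
Lemma measurable_caratheodory {dO dS} {Omega : measurableType dO}
    {S : measurableType dS} (Phi : S -> 'rV[R]_d -> R) (sig : Omega -> S)
    (Y : Omega -> 'rV[R]_d) :
  (forall y, measurable_fun setT (Phi ^~ y)) ->
  (forall w, ccont (Phi (sig w))) ->
  measurable_fun setT sig -> measurable_fun setT Y ->
  measurable_fun setT (fun w => Phi (sig w) (Y w)).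
Proof.
move=> mPhi cPhi msig mY.
apply: (@measurable_fun_cvg _ _ _ setT
  (fun n w => Phi (sig w) (grid n (gridpt n (Y w))))); last first.
  by move=> w _; apply: cPhi => i; exact: cvg_grid.
move=> n _ A mA; rewrite setTI.
have -> : (fun w => Phi (sig w) (grid n (gridpt n (Y w)))) @^-1` A =
    \bigcup_(k in [set: 'rV[int]_d]) ([set w | gridpt n (Y w) = k] `&`
       ((fun w => Phi (sig w) (grid n k)) @^-1` A)).
  apply/seteqP; split=> [w /= Aw|w [k _ [/= -> //]]].
  by exists (gridpt n (Y w)).
apply: countable_bigcupT_measurable => // k; apply: measurableI.
  exact: measurable_gridpt.
rewrite -[_ @^-1` _]setTI.
exact: (measurableT_comp (mPhi (grid n k)) msig).
Qed.

Lemma measurable_ccont {dO} {Omega : measurableType dO} (phi : 'rV[R]_d -> R)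
    (Y : Omega -> 'rV[R]_d) :
  ccont phi -> measurable_fun setT Y ->
  measurable_fun setT (fun w => phi (Y w)).
Proof.
move=> cphi mY.
exact: (@measurable_caratheodory _ _ _ _ (fun (_ : Omega) => phi) id).
Qed.

Lemma cvg_enorm (s : nat -> 'rV[R]_d) (y : 'rV[R]_d) :
  (forall i, s n ord0 i @[n --> \oo] --> y ord0 i) ->
  enorm (s n) @[n --> \oo] --> enorm y.
Proof.
move=> sy.
have sy2 : \sum_(i < d) s n ord0 i ^+ 2 @[n --> \oo] -->
    \sum_(i < d) y ord0 i ^+ 2.
  apply: cvg_sum_ord => i.
  exact: (cvg_comp _ _ (sy i) (@exprn_continuous _ 2 _)).
exact: (cvg_comp _ _ sy2 (@sqrt_continuous _ _)).
Qed.

Lemma cvg_enormB (s : nat -> 'rV[R]_d) (y : 'rV[R]_d) :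
  (forall i, s n ord0 i @[n --> \oo] --> y ord0 i) ->
  enorm (s n - y) @[n --> \oo] --> 0.
Proof.
move=> sy; have -> : 0 = enorm (0 : 'rV[R]_d).
  by rewrite /enorm big1 ?sqrtr0// => i _; rewrite mxE expr0n.
apply: cvg_enorm => i; under eq_fun do rewrite !mxE.
by rewrite mxE -(subrr (y ord0 i)); apply: cvgB => //; exact: cvg_cst.
Qed.

Lemma smooth_ccont (L : R) phi g : smooth_with L phi g -> ccont phi.
Proof.
move=> sphi s y sy; apply/subr_cvg0.
apply/norm_cvg0P.
have e0 := cvg_enormB _ _ sy.
apply: (@squeeze_cvgr _ _ _ _ (cst 0) (fun n => enorm (g y) * enorm (s n - y)
  + L / 2 * enorm (s n - y) ^+ 2)); last 2 first.
- exact: cvg_cst.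
- rewrite (_ : 0 = enorm (g y) * 0 + L / 2 * 0 ^+ 2);
  last by rewrite expr0n/= !mulr0 addr0.
  apply: cvgD; first by apply: cvgM => //; exact: cvg_cst.
  apply: cvgM; first exact: cvg_cst.
  exact: (cvg_comp _ _ e0 (@exprn_continuous _ 2 _)).
near=> n; rewrite normr_ge0/=.
have := sphi y (s n - y); rewrite [y + _]addrC subrK => sn.
rewrite -[_ - phi y](subrK (dotv (g y) (s n - y))) addrC.
rewrite (le_trans (ler_normD _ _))// lerD// normr_dotv_le//.
Unshelve. all: by end_near. Qed.

Lemma lipschitz_ccont (L : R) (g : 'rV[R]_d -> 'rV[R]_d) i :
  (forall y z, enorm (g y - g z) <= L * enorm (y - z)) ->
  ccont (fun y => g y ord0 i).
Proof.
move=> Lip s y sy; apply/subr_cvg0; apply/norm_cvg0P.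
have e0 := cvg_enormB _ _ sy.
apply: (@squeeze_cvgr _ _ _ _ (cst 0) (fun n => L * enorm (s n - y)));
  last 2 first.
- exact: cvg_cst.
- by rewrite -(mulr0 L); apply: cvgM => //; exact: cvg_cst.
near=> n; rewrite normr_ge0/=; apply: le_trans (Lip _ _).
by have := coord_le_enorm (g (s n) - g y) i; rewrite !mxE.
Unshelve. all: by end_near. Qed.

End Measurability.

(** * Averages of smooth families *)

Section Average.
Context {R : realType} {dS} {S : measurableType dS}.
Context (nu : {measure set S -> \bar R}) (D : set S) (k : R).
Context (mD : measurable D) (k0 : 0 <= k) (kD : k * fine (nu D) = 1).
Context (finD : (nu D < +oo)%E).

Local Notation intble f := (nu.-integrable D (EFin \o f)).

(** The factor [k] normalizes the mass of [D], so that the expectation under a probability ([k = 1])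
    and the mean over the unit ball are both instances. *)
Definition avg (f : S -> R) : R := k * \int[nu]_(s in D) f s.

Lemma intble_cst (r : R) : intble (fun _ : S => r).
Proof.
apply: measurable_bounded_integrable => //.
by exists `|r|; split; [exact: num_real|move=> M rM s _ /=; exact: ltW].
Qed.

Lemma intbleB f g : intble f -> intble g -> intble (fun s => f s - g s).
Proof. exact: integrableB. Qed.

Lemma intbleZr f (r : R) : intble f -> intble (fun s => f s * r).
Proof. exact: integrableZr. Qed.

Lemma intble_sum {n} (f : 'I_n -> S -> R) : (forall i, intble (f i)) ->
  intble (fun s => \sum_(i < n) f i s).
Proof.
move=> fint; apply: eq_integrable (integrable_sum mD (index_enum 'I_n)
  (fun i (_ : true) => fint i)) => // s _.
by rewrite /= sumEFin.
Qed.

Lemma avg_cst (r : R) : avg (fun=> r) = r.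
Proof. by rewrite /avg Rintegral_cst// mulrCA kD mulr1. Qed.

Lemma avgB f g : intble f -> intble g ->
  avg (fun s => f s - g s) = avg f - avg g.
Proof. by move=> fi gi; rewrite /avg RintegralB// mulrBr. Qed.

Lemma avgZr f (r : R) : intble f -> avg (fun s => f s * r) = avg f * r.
Proof. by move=> fi; rewrite /avg RintegralZr// mulrA. Qed.

Lemma avg_sum {n} (f : 'I_n -> S -> R) : (forall i, intble (f i)) ->
  avg (fun s => \sum_(i < n) f i s) = \sum_(i < n) avg (f i).
Proof.
move=> fint; rewrite /avg -mulr_sumr; congr (_ * _).
have H (r : seq 'I_n) : \int[nu]_(s in D) (\sum_(i <- r) f i s) =
    \sum_(i <- r) \int[nu]_(s in D) f i s.
  elim: r => [|i r IH].
    rewrite big_nil -[RHS](mul0r (fine (nu D))) -Rintegral_cst//.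
    by apply: eq_Rintegral => s _; rewrite big_nil.
  rewrite big_cons -IH -RintegralD//.
    by apply: eq_Rintegral => s _; rewrite big_cons.
  apply: eq_integrable (integrable_sum mD r
    (fun i (_ : true) => fint i)) => // s _.
  by rewrite /= sumEFin.
exact: H.
Qed.

Lemma avg_le f g : intble f -> intble g -> (forall s, D s -> f s <= g s) ->
  avg f <= avg g.
Proof. by move=> fi gi fg; rewrite ler_wpM2l// le_Rintegral. Qed.

Lemma avg_ge0 f : (forall s, D s -> 0 <= f s) -> 0 <= avg f.
Proof. by move=> f0; rewrite mulr_ge0// Rintegral_ge0. Qed.

Lemma normr_avg_le f (r : R) : intble f -> (forall s, D s -> `|f s| <= r) ->
  `|avg f| <= r.
Proof.
move=> fi fr; rewrite ler_norml; apply/andP; split.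
  rewrite -(avg_cst (- r)); apply: avg_le => //; first exact: intble_cst.
  by move=> s /fr; rewrite ler_norml => /andP[].
rewrite -[leRHS]avg_cst; apply: avg_le => //; first exact: intble_cst.
by move=> s /fr; rewrite ler_norml => /andP[].
Qed.

Section Rows.
Context {d : nat}.
Implicit Types (v : S -> 'rV[R]_d) (p : 'rV[R]_d).

Definition rintble v := forall i, intble (fun s => v s ord0 i).
Definition ravg v : 'rV[R]_d := \row_i avg (fun s => v s ord0 i).

Lemma intble_dotv v p : rintble v -> intble (fun s => dotv (v s) p).
Proof.
by move=> vi; apply: intble_sum => i; apply: intbleZr.
Qed.

Lemma avg_dotv v p : rintble v -> avg (fun s => dotv (v s) p) = dotv (ravg v) p.
Proof.
move=> vi; rewrite /dotv avg_sum; last by move=> i; exact: intbleZr.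
by apply: eq_bigr => i _; rewrite avgZr// mxE.
Qed.

Lemma ravgB v w : rintble v -> rintble w ->
  ravg (fun s => v s - w s) = ravg v - ravg w.
Proof.
move=> vi wi; apply/rowP => i; rewrite !mxE -avgB//.
by congr avg; apply/funext => s; rewrite !mxE.
Qed.

(** Pair the mean [b] with itself: [enorm b ^+ 2] is the average of [dotv (v s) b], at most
    [enorm b * avg B] by Cauchy-Schwarz. Dividing requires [b] nonzero; otherwise [avg B >= 0]
    suffices. *)
Lemma enorm_ravg_le v (B : S -> R) : rintble v -> intble B ->
  (forall s, D s -> enorm (v s) <= B s) -> enorm (ravg v) <= avg B.
Proof.
move=> vi Bi vB; set b := ravg v.
have bb : enorm b * enorm b <= enorm b * avg B.
  rewrite -expr2 -dotvv /b -avg_dotv// -/b mulrC -avgZr//.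
  apply: avg_le => [||s Ds]; [exact: intble_dotv|exact: intbleZr|].
  by rewrite (le_trans (dotv_le_enorm _ _))// ler_wpM2r ?enorm_ge0// vB.
have [b0|b0] := eqVneq (enorm b) 0; last first.
  by move: bb; rewrite ler_pM2l// lt_def b0 enorm_ge0.
rewrite b0 -(avg_cst 0); apply: avg_le => //; first exact: intble_cst.
by move=> s Ds; apply: le_trans (vB s Ds); exact: enorm_ge0.
Qed.

Context (L : R) (Phi : S -> 'rV[R]_d -> R) (g : S -> 'rV[R]_d -> 'rV[R]_d).
Context (Phi_int : forall y, intble (Phi ^~ y)).
Context (g_int : forall y, rintble (g ^~ y)).

(** The expression bounded in [smooth_with] is linear in the pair of function and gradient, so its
    average is the same expression for the averages. *)
Lemma avg_smooth : (forall s, D s -> smooth_with L (Phi s) (g s)) ->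
  smooth_with L (fun y => avg (Phi ^~ y)) (fun y => ravg (g ^~ y)).
Proof.
move=> sPhi y h; rewrite -avg_dotv// -!avgB//; last 2 first.
- exact: intbleB.
- exact: intble_dotv.
apply: normr_avg_le => [|s Ds]; last exact: sPhi.
by apply: intbleB; [exact: intbleB|exact: intble_dotv].
Qed.

Lemma ravg_lipschitz :
  (forall s y z, D s -> enorm (g s y - g s z) <= L * enorm (y - z)) ->
  forall y z, enorm (ravg (g ^~ y) - ravg (g ^~ z)) <= L * enorm (y - z).
Proof.
move=> Lip y z; rewrite -ravgB// -[leRHS]avg_cst.
apply: enorm_ravg_le => [i||s Ds]; [|exact: intble_cst|exact: Lip].
have := intbleB _ _ (g_int y i) (g_int z i).
by apply: eq_integrable => // s _; rewrite /= !mxE.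
Qed.

End Rows.
End Average.

(** * Growth of smooth functions and measurability of their gradients *)

Section SmoothBounds.
Context {R : realType} {d : nat}.

Lemma smooth_bound (L : R) (phi : 'rV[R]_d -> R) g y h : smooth_with L phi g ->
  `|phi (y + h)| <= `|phi y| + enorm (g y) * enorm h + L / 2 * enorm h ^+ 2.
Proof.
move=> sphi; have := sphi y h; have := normr_dotv_le (g y) h.
move=> b1 b2.
rewrite (_ : phi (y + h) = phi y + dotv (g y) h +
  (phi (y + h) - phi y - dotv (g y) h)); last by ring.
rewrite (le_trans (ler_normD _ _))// lerD// (le_trans (ler_normD _ _))//.
by rewrite lerD.
Qed.

(** A gradient coordinate is the limit of difference quotients of step [n.+1%:R^-1], each measurable
    in [s]; the error is at most [L / 2 * harmonic n]. *)
Lemma smooth_grad_measurable {dS} {S : measurableType dS} (L : R)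
    (Phi : S -> 'rV[R]_d -> R) (g : S -> 'rV[R]_d -> 'rV[R]_d) y i :
  (forall y, measurable_fun setT (Phi ^~ y)) ->
  (forall s, smooth_with L (Phi s) (g s)) ->
  measurable_fun setT (fun s => g s y ord0 i).
Proof.
move=> mPhi sPhi.
apply: (@measurable_fun_cvg _ _ _ setT (fun n s => n.+1%:R *
   (Phi s (y + n.+1%:R^-1 *: delta_mx ord0 i) - Phi s y))).
  by move=> n; apply: measurable_funM => //; exact: measurable_funB.
move=> s _; apply/subr_cvg0/norm_cvg0P.
apply: (@squeeze_cvgr _ _ _ _ (cst 0) (fun n => L / 2 * harmonic n)).
- near=> n; rewrite normr_ge0/=.
  have n0 : (0 : R) < n.+1%:R by [].
  have := sPhi s y (n.+1%:R^-1 *: delta_mx ord0 i).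
  rewrite enormZ enorm_delta mulr1 dotvZr dotv_delta => sn.
  rewrite -(ler_pM2l (_ : 0 < n.+1%:R^-1)) ?invr_gt0//.
  rewrite -[X in X * _ <= _](gtr0_norm (_ : 0 < n.+1%:R^-1)) ?invr_gt0//.
  rewrite -normrM mulrBr mulKf ?gt_eqF//.
  rewrite (le_trans sn)// gtr0_norm ?invr_gt0//. by rewrite expr2 mulrCA.
- exact: cvg_cst.
- rewrite -(mulr0 (L / 2)); apply: cvgM; first exact: cvg_cst.
  exact: cvg_harmonic.
Unshelve. all: by end_near. Qed.

End SmoothBounds.

(** * Volume of the unit ball and smoothing over it *)

Section UnitBall.
Context {R : realType} {d : nat}.
Context (lam : {measure set 'rV[R]_d -> \bar R}).
Context (d0 : (0 < d)%N) (lamP : is_lebesgue_rV lam).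

Local Notation ball1 := (unit_ball : set 'rV[R]_d).

Lemma measurable_enorm : measurable_fun setT (enorm : 'rV[R]_d -> R).
Proof.
apply: (@measurable_ccont R d _ _ enorm id) => // s y sy; exact: cvg_enorm.
Qed.

Lemma measurable_enorm_le (r : R) :
  measurable [set w : 'rV[R]_d | enorm w <= r].
Proof.
rewrite (_ : [set _ | _] = enorm @^-1` `]-oo, r]%classic).
  by rewrite -[_ @^-1` _]setTI; exact: measurable_enorm.
by apply/seteqP; split => w /=; rewrite in_itv.
Qed.

Lemma measurable_unit_ball : measurable ball1.
Proof. exact: measurable_enorm_le. Qed.

Lemma measurable_box (a b : 'rV[R]_d) :
  measurable [set x : 'rV[R]_d | forall i, a ord0 i <= x ord0 i <= b ord0 i].
Proof.
rewrite (_ : [set _ | _] = \bigcap_(i in [set: 'I_d])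
    (fun x : 'rV[R]_d => x ord0 i) @^-1` `[a ord0 i, b ord0 i]%classic).
  apply: fin_bigcap_measurable => // i _.
  by rewrite -[_ @^-1` _]setTI; exact: measurable_coord.
by apply/seteqP; split => [w /= H i _/=|w /= H i];
  [rewrite in_itv/= H|have := H i Logic.I; rewrite /= in_itv].
Qed.

Lemma unit_ball_lty : (lam ball1 < +oo)%E.
Proof.
pose a : 'rV[R]_d := const_mx (-1); pose b : 'rV[R]_d := const_mx 1.
apply: (@le_lt_trans _ _ (lam [set x | forall i, a ord0 i <= x ord0 i <=
  b ord0 i])).
  apply: le_measure; rewrite ?inE;
    [exact: measurable_unit_ball|exact: measurable_box|].
  move=> w /= w1 i; rewrite !mxE -ler_norml.
  exact: le_trans (coord_le_enorm w i) w1.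
by rewrite lamP ?ltry// => i; rewrite !mxE; lra.
Qed.

(** Volumes are given on boxes only. The cube of half-side [1 / d] lies in the ball, since its
    points have squared norm at most [d * (1 / d) ^+ 2 = 1 / d]. *)
Lemma unit_ball_gt0 : 0 < fine (lam ball1).
Proof.
pose r : R := d%:R^-1.
have r0 : 0 < r by rewrite invr_gt0 ltr0n.
pose a : 'rV[R]_d := const_mx (- r); pose b : 'rV[R]_d := const_mx r.
rewrite fine_gt0// unit_ball_lty andbT.
apply: (@lt_le_trans _ _ (lam [set x | forall i, a ord0 i <= x ord0 i <=
  b ord0 i])).
  rewrite lamP; last by move=> i; rewrite !mxE; lra.
  by rewrite lte_fin prodr_gt0// => i _; rewrite !mxE; lra.
apply: le_measure; rewrite ?inE;
  [exact: measurable_box|exact: measurable_unit_ball|].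
move=> w /= wr; rewrite /unit_ball/= -(@ler_pXn2r _ 2) ?nnegrE ?enorm_ge0//.
rewrite sqr_enorm expr1n.
apply: (@le_trans _ _ (\sum_(i < d) r ^+ 2)).
  apply: ler_sum => i _; rewrite -real_normK ?num_real// ler_pXn2r ?nnegrE
    ?(ltW r0)//.
  by have := wr i; rewrite !mxE ler_norml.
rewrite sumr_const card_ord -mulr_natl expr2 mulrA divff ?mul1r.
  by rewrite invf_le1 ?ltr0n// ler1n.
by rewrite pnatr_eq0 -lt0n.
Qed.

Lemma unit_ball_normalized : (fine (lam ball1))^-1 * fine (lam ball1) = 1.
Proof. by rewrite mulVf// gt_eqF// unit_ball_gt0. Qed.

Lemma unit_ball_bounded_intble (f : 'rV[R]_d -> R) (M : R) :
  measurable_fun setT f -> (forall w, enorm w <= 1 -> `|f w| <= M) ->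
  lam.-integrable ball1 (EFin \o f).
Proof.
move=> mf fM; apply: measurable_bounded_integrable.
- exact: measurable_unit_ball.
- exact: unit_ball_lty.
- exact: measurable_funTS.
- exists M; split; [exact: num_real|move=> M' MM' w w1 /=].
  exact: le_trans (fM w w1) (ltW MM').
Qed.

Local Notation bavg := (avg lam ball1 (fine (lam ball1))^-1).

Lemma bavg_enorm_le1 : bavg enorm <= 1.
Proof.
rewrite -(avg_cst _ _ _ measurable_unit_ball unit_ball_normalized 1).
apply: avg_le => //.
- exact: measurable_unit_ball.
- apply: (@unit_ball_bounded_intble _ 1); first exact: measurable_enorm.
  by move=> w; rewrite ger0_norm ?enorm_ge0.
- by apply: intble_cst; [exact: measurable_unit_ball|exact: unit_ball_lty].
Qed.

Context (L mu : R) (f : 'rV[R]_d -> R) (g : 'rV[R]_d -> 'rV[R]_d).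
Context (L0 : 0 <= L) (mu0 : 0 <= mu) (sf : smooth_with L f g).
Context (Lip : forall y z, enorm (g y - g z) <= L * enorm (y - z)).

Lemma measurable_shift (y : 'rV[R]_d) :
  measurable_fun setT (fun w : 'rV[R]_d => y + mu *: w).
Proof.
apply/measurable_fun_rVP => i.
under eq_fun do rewrite !mxE.
apply: measurable_funD => //; apply: measurable_funM => //.
exact: measurable_coord.
Qed.

Lemma intble_shift y : lam.-integrable ball1 (EFin \o fun w => f (y + mu *: w)).
Proof.
apply: (@unit_ball_bounded_intble _
  (`|f y| + enorm (g y) * mu + L / 2 * mu ^+ 2)).
  apply: (measurable_ccont f); last exact: measurable_shift.
  exact: smooth_ccont sf.
move=> w w1; apply: (le_trans (smooth_bound _ _ _ _ _ sf)).
have w2 : enorm (mu *: w) <= mu.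
  by rewrite enormZ ger0_norm// ler_piMr.
rewrite lerD//; first by rewrite lerD// ler_wpM2l ?enorm_ge0.
by rewrite ler_wpM2l ?divr_ge0// ler_pXn2r ?nnegrE ?enorm_ge0.
Qed.

Lemma rintble_shift y : rintble lam ball1 (fun w => g (y + mu *: w)).
Proof.
move=> i; apply: (@unit_ball_bounded_intble _ (enorm (g y) + L * mu)).
  apply: (measurable_ccont (fun z => g z ord0 i)); last exact: measurable_shift.
  exact: lipschitz_ccont Lip.
move=> w w1; apply: (le_trans (coord_le_enorm _ _)).
rewrite -[g (y + _)](subrK (g y)) addrC (le_trans (ler_enormD _ _))// lerD2l.
rewrite (le_trans (Lip _ _))// [y + _]addrC addrK ler_wpM2l// enormZ.
by rewrite ger0_norm// ler_piMr.
Qed.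

Lemma ball_avg_smooth : smooth_with L (fun y => bavg (fun w => f (y + mu *: w)))
  (fun y => ravg lam ball1 (fine (lam ball1))^-1 (fun w => g (y + mu *: w))).
Proof.
apply: (@avg_smooth R _ _ lam ball1 _ measurable_unit_ball _
  unit_ball_normalized unit_ball_lty d L (fun w y => f (y + mu *: w))
  (fun w y => g (y + mu *: w)) intble_shift rintble_shift) => //.
by move=> w _ y h; rewrite [y + h + _]addrAC; exact: sf.
Qed.

Lemma ball_avg_lipschitz y z :
  enorm (ravg lam ball1 (fine (lam ball1))^-1 (fun w => g (y + mu *: w)) -
    ravg lam ball1 (fine (lam ball1))^-1 (fun w => g (z + mu *: w))) <=
  L * enorm (y - z).
Proof.
apply: (@ravg_lipschitz R _ _ lam ball1 _ measurable_unit_ball _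
  unit_ball_normalized unit_ball_lty d L
  (fun w y => g (y + mu *: w)) rintble_shift) => //.
move=> w {}y {}z _; apply: le_trans (Lip _ _) _.
by rewrite opprD addrACA subrr addr0.
Qed.

(** Since [g y] is its own mean, the bias is the mean of [g (y + mu *: w) - g y]. The factor
    [bavg enorm] is kept rather than bounded by 1, because dimension one needs the sharper value. *)
Lemma ball_avg_bias y :
  enorm (ravg lam ball1 (fine (lam ball1))^-1 (fun w => g (y + mu *: w)) - g y)
  <= L * mu * bavg enorm.
Proof.
have gy : g y = ravg lam ball1 (fine (lam ball1))^-1 (fun=> g y).
  apply/rowP => i; rewrite mxE avg_cst//; first exact: measurable_unit_ball.
  exact: unit_ball_normalized.
have yint : rintble lam ball1 (fun=> g y).
  by move=> i; apply: intble_cst;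
    [exact: measurable_unit_ball|exact: unit_ball_lty].
have eint : lam.-integrable ball1 (EFin \o (enorm : 'rV[R]_d -> R)).
  apply: (@unit_ball_bounded_intble _ 1); first exact: measurable_enorm.
  by move=> w; rewrite ger0_norm ?enorm_ge0.
rewrite gy -ravgB//; [|exact: measurable_unit_ball|exact: rintble_shift].
rewrite mulrC -avgZr//; last exact: measurable_unit_ball.
apply: enorm_ravg_le => //.
- exact: measurable_unit_ball.
- exact: unit_ball_normalized.
- exact: unit_ball_lty.
- move=> i.
  have := intbleB _ _ measurable_unit_ball _ _ (rintble_shift y i) (yint i).
  apply: eq_integrable => [|w _]; first exact: measurable_unit_ball.
  by rewrite /= !mxE.
- by apply: intbleZr => //; exact: measurable_unit_ball.
move=> w _; rewrite (le_trans (Lip _ _))// [y + _]addrC addrK enormZ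
  ger0_norm//.
by rewrite [leRHS]mulrC mulrA.
Qed.

End UnitBall.

(* In dimension one the trivial bound [1] on the mean of [enorm] over the unit
   ball exceeds the [sqrt (1 / 2)] allowed by [bavg_enorm_sqr]; three layers of
   width [1 / 3] suffice. *)
Lemma bavg_enorm_dim1 {R : realType} (lam : {measure set 'rV[R]_1 -> \bar R}) :
  is_lebesgue_rV lam ->
  avg lam unit_ball (fine (lam unit_ball))^-1 enorm <= 2 / 3.
Proof.
move=> lamP.
have lamE (a : R) : 0 <= a ->
    lam [set w : 'rV[R]_1 | enorm w <= a] = (2 * a)%:E.
  move=> a0; rewrite (_ : [set _ | _] = [set w : 'rV[R]_1 | forall i,
      (const_mx (- a) : 'rV[R]_1) ord0 i <= w ord0 i <=
      (const_mx a : 'rV[R]_1) ord0 i]).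
    rewrite lamP; last by move=> i; rewrite !mxE; lra.
    by rewrite big_ord1 !mxE; congr (_%:E); ring.
  apply/seteqP; split=> w /=.
    by move=> wa i; rewrite !mxE -ler_norml (le_trans (coord_le_enorm w i)).
  move=> /(_ ord0); rewrite !mxE -ler_norml.
  by rewrite /enorm big_ord1 sqrtr_sqr.
have mle := @measurable_enorm_le R 1; have mb := @measurable_unit_ball R 1.
have vol : fine (lam unit_ball) = 2 by rewrite /unit_ball lamE//= mulr1.
have fin := unit_ball_lty lam lamP.
have k1 := unit_ball_normalized lam isT lamP.
pose A (a : R) := [set w : 'rV[R]_1 | enorm w <= a].
have iA a : lam.-integrable unit_ball (EFin \o \1_(A a)).
  apply: (@unit_ball_bounded_intble _ _ lam lamP _ 1) => [|w _].
    by apply: measurable_indic; exact: mle.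
  by rewrite indicE; case: (_ \in _); rewrite /= ?normr1 ?normr0.
have aA a : 0 <= a <= 1 ->
    avg lam unit_ball (fine (lam unit_ball))^-1 \1_(A a) = a.
  move=> /andP[a0 a1]; rewrite /avg /Rintegral integral_indic//;
    last exact: mle.
  rewrite setIidl; last by move=> w /= wa; exact: le_trans wa a1.
  by rewrite vol lamE//=; field.
(* A step function above [enorm], with values 1/3, 2/3 and 1 on the three layers; its mean is
   [1 - 2/9 - 1/9 = 2/3]. *)
pose B (w : 'rV[R]_1) : R := 1 - \1_(A (2 / 3)) w * (1 / 3) - \1_(A (1 / 3)) w
  * (1 / 3).
have ib a : lam.-integrable unit_ball (EFin \o fun w => \1_(A a) w * (1 / 3)).
  exact: intbleZr.
have ic := intble_cst lam unit_ball mb fin 1.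
apply: (@le_trans _ _ (avg lam unit_ball (fine (lam unit_ball))^-1 B)).
  apply: avg_le => //.
  - apply: (@unit_ball_bounded_intble _ _ lam lamP _ 1);
    first exact: measurable_enorm.
    by move=> w; rewrite ger0_norm ?enorm_ge0.
  - by apply: intbleB => //; exact: intbleB.
  move=> w; rewrite /unit_ball/= => w1; rewrite /B !indicE.
  have inA (a : R) : (w \in A a) = (enorm w <= a).
    by apply/idP/idP; rewrite inE.
  rewrite !inA; case: (leP (enorm w) (1 / 3)) => w13;
    case: (leP (enorm w) (2 / 3)) => w23; rewrite ?mulr1n ?mulr0n; lra.
rewrite /B avgB//; last by exact: intbleB.
by rewrite avgB// avg_cst// !avgZr// !aA; lra.
Qed.

(** The right-hand side is what the final constant allows once [mu ^+ 2 = 1 / (T * d)]. For [d >= 2]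
    it is at least 2, so the trivial bound 1 is enough; for [d = 1] one has [4/9 <= 1/2]. *)
Lemma bavg_enorm_sqr {R : realType} {d : nat}
    (lam : {measure set 'rV[R]_d -> \bar R}) : (0 < d)%N ->
      is_lebesgue_rV lam ->
  avg lam unit_ball (fine (lam unit_ball))^-1 enorm ^+ 2 <= d%:R ^+ 2 / 2.
Proof.
move=> d0 lamP; set b := avg _ _ _ _.
have b0 : 0 <= b.
  apply: avg_ge0 => [|w _]; last exact: enorm_ge0.
  by rewrite invr_ge0 ltW// unit_ball_gt0.
case: d lam d0 lamP @b b0 => [|[|d]]// lam _ lamP b b0.
  by have := bavg_enorm_dim1 lam lamP; rewrite -/b; nra.
have b1 : b <= 1 := bavg_enorm_le1 lam isT lamP.
have d2 : (2 : R) <= d.+2%:R by rewrite ler_nat.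
by nra.
Qed.

(** * One step of the method *)

Section Prox.
Context {R : realType} {d : nat} (X : set 'rV[R]_d) (c : R).
Context (clX : closed X) (cvX : convex_vset X) (X0 : X !=set0) (c0 : 0 < c).
Implicit Types (h a x g : 'rV[R]_d).

Lemma prox_obj_sum h x g (k : R) y : prox_obj h x g k y =
  \sum_(i < d) (g ord0 i * y ord0 i + k * (h ord0 i * (y - x) ord0 i ^+ 2)).
Proof. by rewrite /prox_obj /dotv /wsq mulr_sumr -big_split. Qed.

(** Each minimizer is tested against the other in [prox_ineq]. The gap between the two sides is
    exactly half the sum of the two slacks. *)
Lemma minimizers_monotone h1 h2 a1 a2 z1 z2 :
  (forall i, 0 <= h1 ord0 i) -> (forall i, 0 <= h2 ord0 i) ->
  minimizers X (prox_obj h1 a1 0 1) z1 ->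
    minimizers X (prox_obj h2 a2 0 1) z2 ->
  wsq h2 (z2 - z1) <= dotv (emul h1 (z1 - a1) - emul h2 (z1 - a2)) (z2 - z1).
Proof.
move=> h10 h20 m1 m2.
have I1 := prox_ineq _ _ _ _ _ _ _ cvX ler01 h10 m1 m2.1.
have I2 := prox_ineq _ _ _ _ _ _ _ cvX ler01 h20 m2 m1.1.
have key : dotv (emul h1 (z1 - a1) - emul h2 (z1 - a2)) (z2 - z1)
    - wsq h2 (z2 - z1) = 2^-1 *
      ((prox_obj h1 a1 0 1 z2 - (prox_obj h1 a1 0 1 z1 + wsq h1 (z2 - z1))) +
       (prox_obj h2 a2 0 1 z1 - (prox_obj h2 a2 0 1 z2 + wsq h2 (z1 - z2)))).
  rewrite !prox_obj_sum /wsq /dotv -!big_split/= -!sumrB -big_split/= mulr_sumr.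
  by apply: eq_bigr => i _; rewrite !mxE; field.
by rewrite -subr_ge0 key mulr_ge0// addr_ge0// subr_ge0 -[wsq _ _]mul1r.
Qed.

(** Continuity of the projection jointly in weights and point, used for measurability. The
    monotonicity estimate is combined with Cauchy-Schwarz and divided by the distance of the two
    projections. *)
Lemma wproj_stability h1 h2 a1 a2 :
  (forall i, c <= h1 ord0 i) -> (forall i, c <= h2 ord0 i) ->
  enorm (wproj X h2 a2 - wproj X h1 a1) <=
    enorm (emul h1 (wproj X h1 a1 - a1) - emul h2 (wproj X h1 a1 - a2)) / c.
Proof.
move=> hc1 hc2; set z1 := wproj X h1 a1; set z2 := wproj X h2 a2;
  set b := emul _ _ - emul _ _.
have h10 i : 0 <= h1 ord0 i by apply: le_trans (hc1 i); exact: ltW.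
have h20 i : 0 <= h2 ord0 i by apply: le_trans (hc2 i); exact: ltW.
have m1 := wproj_minimizes _ _ a1 _ clX X0 c0 hc1.
have m2 := wproj_minimizes _ _ a2 _ clX X0 c0 hc2.
have key : wsq h2 (z2 - z1) <= dotv b (z2 - z1) :=
  minimizers_monotone _ _ _ _ _ _ h10 h20 m1 m2.
rewrite ler_pdivlMr//.
have [->|D0] := eqVneq (enorm (z2 - z1)) 0; first by rewrite mul0r enorm_ge0.
have {}D0 : 0 < enorm (z2 - z1) by rewrite lt_def D0 enorm_ge0.
rewrite -(ler_pM2r D0) (le_trans _ (dotv_le_enorm _ _))//.
by apply: le_trans key; rewrite mulrAC mulrC -expr2; exact: wsq_ge.
Qed.

Lemma cvg_wproj (hn an : nat -> 'rV[R]_d) h a i :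
  (forall n i, c <= hn n ord0 i) ->
  (forall i, c <= h ord0 i) ->
  (forall i, hn n ord0 i @[n --> \oo] --> h ord0 i) ->
  (forall i, an n ord0 i @[n --> \oo] --> a ord0 i) ->
  wproj X (hn n) (an n) ord0 i @[n --> \oo] --> wproj X h a ord0 i.
Proof.
move=> hnc hc hnh ana; apply/subr_cvg0/norm_cvg0P.
set z := wproj X h a.
pose b n := emul h (z - a) - emul (hn n) (z - an n).
apply: (@squeeze_cvgr _ _ _ _ (cst 0) (fun n => enorm (b n) / c)).
- near=> n; rewrite normr_ge0/=.
  apply: le_trans (wproj_stability h (hn n) a (an n) hc (hnc n)).
  by have := coord_le_enorm (wproj X (hn n) (an n) - z) i; rewrite !mxE.
- exact: cvg_cst.
- rewrite -(mul0r c^-1); apply: cvgM; last exact: cvg_cst.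
  have -> : 0 = enorm (0 : 'rV[R]_d).
    by rewrite /enorm big1 ?sqrtr0// => j _; rewrite mxE expr0n.
  apply: cvg_enorm => j; under eq_fun do rewrite !mxE.
  rewrite mxE -(subrr (h ord0 j * (z ord0 j - a ord0 j))).
  apply: cvgB; first exact: cvg_cst.
  by apply: cvgM => //; apply: cvgB => //; exact: cvg_cst.
Unshelve. all: by end_near. Qed.

Lemma measurable_wproj {dO} {Omega : measurableType dO}
    (H Y : Omega -> 'rV[R]_d) :
  (forall w i, c <= H w ord0 i) ->
  measurable_fun setT H -> measurable_fun setT Y ->
  measurable_fun setT (fun w => wproj X (H w) (Y w)).
Proof.
move=> Hc mH mY; apply/measurable_fun_rVP => i.
(* [clip] forces every weight vector above [c] and fixes the values of [H], so the projection
   becomes continuous for all [h], as the Caratheodory argument requires. *)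
pose clip h : 'rV[R]_d := \row_j (c + `|h ord0 j - c|).
have clipc h j : c <= clip h ord0 j by rewrite mxE lerDl normr_ge0.
have HE w : clip (H w) = H w by apply/rowP => j;
  rewrite mxE ger0_norm ?subr_ge0// addrC subrK.
have -> : (fun w => wproj X (H w) (Y w) ord0 i) =
    (fun w => wproj X (clip (H w)) (Y w) ord0 i).
  by apply/funext => w; rewrite HE.
apply: (measurable_caratheodory (fun h y => wproj X (clip h) y ord0 i)) => //.
- move=> y; apply: (@measurable_ccont R d _ _
    (fun h => wproj X (clip h) y ord0 i) id) => // s h sh.
  apply: cvg_wproj => // j; last exact: cvg_cst.
  under eq_fun do rewrite mxE; rewrite mxE.
  apply: cvgD; first exact: cvg_cst.
  by apply: cvg_norm; apply: cvgB => //; exact: cvg_cst.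
- move=> w s y sy; apply: cvg_wproj => // j.
  exact: cvg_cst.
Qed.

Context (L al : R) (al0 : 0 < al) (alL : al * L <= c).

Lemma wsq_gmap h x g : wsq h (gmap X h x g al) =
  al ^- 2 * wsq h (x - gm_xplus X h x g al).
Proof. by rewrite wsqZ exprVn. Qed.

(** Adding the growth inequalities of the two minimizers bounds twice [k * W], with
    [k = (2 * al)^-1], by an inner product; Young's inequality absorbs one copy, and the factor
    [2 / al] rescales to the gradient mapping. *)
Lemma gmap_stability h x g1 g2 : (forall i, c <= h ord0 i) ->
  wsq h (gmap X h x g1 al - gmap X h x g2 al) <= enorm (g1 - g2) ^+ 2 / c.
Proof.
move=> hc; rewrite /gmap -scalerBr.
set z1 := gm_xplus X h x g1 al; set z2 := gm_xplus X h x g2 al.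
have h0 i : 0 <= h ord0 i by apply: le_trans (hc i); exact: ltW.
have m1 := gm_xplus_minimizes _ _ x g1 _ _ clX X0 al0 c0 hc.
have m2 := gm_xplus_minimizes _ _ x g2 _ _ clX X0 al0 c0 hc.
have k0 : 0 < (2 * al)^-1 by rewrite invr_gt0 mulr_gt0.
rewrite -/z1 in m1; rewrite -/z2 in m2; clearbody z1 z2.
have I1 := prox_ineq _ _ _ _ _ _ _ cvX (ltW k0) h0 m1 m2.1.
have I2 := prox_ineq _ _ _ _ _ _ _ cvX (ltW k0) h0 m2 m1.1.
 rewrite wsqB in I2.
have Y := dotv_le_young _ (g1 - g2) (z2 - z1) _ _ c0 k0 hc.
have -> : x - z1 - (x - z2) = z2 - z1.
  by rewrite opprB addrC addrA subrK.
rewrite wsqZ; set W := wsq h (z2 - z1) in I1 I2 Y *.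
have E : dotv (g1 - g2) (z2 - z1) =
    dotv g1 z2 - dotv g1 z1 - dotv g2 z2 + dotv g2 z1.
  by rewrite dotvBl !dotvBr; ring.
rewrite E in Y; rewrite /prox_obj in I1 I2.
have Y2 : (2 * al)^-1 * W <= (4 * (2 * al)^-1 * c)^-1 * enorm (g1 - g2) ^+ 2.
  by move: I1 I2 Y; lra.
have := ler_wpM2l (_ : 0 <= 2 / al) Y2.
rewrite divr_ge0 ?(ltW al0)// => /(_ isT).
rewrite (_ : 2 / al * ((2 * al)^-1 * W) = al^-1 ^+ 2 * W); last first.
  by field; rewrite gt_eqF.
by rewrite (_ : 2 / al * _ = enorm (g1 - g2) ^+ 2 / c)//; field;
  rewrite !gt_eqF.
Qed.

Lemma descent_step phi (g : 'rV[R]_d ->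
  'rV[R]_d) h x gh : smooth_with L phi g -> X x ->
  (forall i, c <= h ord0 i) ->
  wsq h (gmap X h x (g x) al) <=
    2 / al * (phi x - phi (gm_xplus X h x gh al)) + enorm (gh - g x) ^+ 2 / c.
Proof.
move=> sphi Xx hc; rewrite wsq_gmap.
set z := gm_xplus X h x gh al; set q := gm_xplus X h x (g x) al.
have h0 i : 0 <= h ord0 i by apply: le_trans (hc i); exact: ltW.
have mz := gm_xplus_minimizes _ _ x gh _ _ clX X0 al0 c0 hc.
have mq := gm_xplus_minimizes _ _ x (g x) _ _ clX X0 al0 c0 hc.
have k0 : 0 < (2 * al)^-1 by rewrite invr_gt0 mulr_gt0.
rewrite -/z in mz; rewrite -/q in mq; clearbody z q.
have I1 := prox_ineq _ _ _ _ _ _ _ cvX (ltW k0) h0 mz mq.1.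
have I2 := prox_ineq _ _ _ _ _ _ _ cvX (ltW k0) h0 mq Xx.
(* With this choice of [k], the quadratic term of Young's inequality cancels the growth term
   [k * wsq h (q - z)] in [I1]. *)
have Y := dotv_le_young _ (gh - g x) (q - z) _ _ c0 k0 hc.
have E : dotv (gh - g x) (q - z) =
    dotv gh q - dotv gh z - dotv (g x) q + dotv (g x) z.
  by rewrite dotvBl !dotvBr; ring.
rewrite E in Y; rewrite /prox_obj in I1 I2.
have Wxx : wsq h (x - x) = 0.
  by rewrite subrr /wsq big1// => i _; rewrite mxE expr0n mulr0.
rewrite Wxx in I2.
have S1 : phi z <= phi x + dotv (g x) z - dotv (g x) x + L / 2 * enorm (z - x)
  ^+ 2.
  have := sphi x (z - x); rewrite [x + _]addrC subrK dotvBr ler_norml.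
  by move=> /andP[_]; lra.
(* The step size condition [al * L <= c] enters here: the proximal term dominates the curvature of
   [phi]. *)
have S2 : L / 2 * enorm (z - x) ^+ 2 <= (2 * al)^-1 * wsq h (z - x).
  apply: (@le_trans _ _ ((2 * al)^-1 * (c * enorm (z - x) ^+ 2))); last first.
    by rewrite ler_pM2l//; exact: wsq_ge.
  rewrite (mulrA _ c) ler_wpM2r ?sqr_ge0// ler_pdivlMl ?mulr_gt0//.
  by rewrite (_ : 2 * al * (L / 2) = al * L)//; field.
have main : (2 * al)^-1 * wsq h (x - q) <=
    phi x - phi z + (4 * (2 * al)^-1 * c)^-1 * enorm (gh - g x) ^+ 2.
  by move: I1 I2 Y S1 S2; lra.
have := ler_wpM2l (_ : 0 <= 2 / al) main.
rewrite divr_ge0 ?(ltW al0)// => /(_ isT).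
rewrite (_ : 2 / al * ((2 * al)^-1 * _) = al ^- 2 * wsq h (x - q)); last first.
  by field; rewrite gt_eqF.
rewrite mulrDr (_ : 2 / al * ((4 * _ * c)^-1 * _) =
  enorm (gh - g x) ^+ 2 / c)//.
by field; rewrite !gt_eqF.
Qed.

(** Passes from the gradient [g x] to [gf] through [r ^+ 2 <= 3 * p ^+ 2 + 3 / 2 * (p - r) ^+ 2],
    whose slack is [(3 * p - r) ^+ 2 / 2]. The weight 3 turns [2 / al] into the target [6 / al]. *)
Lemma gmap_sqr_le phi (g : 'rV[R]_d ->
  'rV[R]_d) h x gh gf : smooth_with L phi g -> X x ->
  (forall i, c <= h ord0 i) ->
  wsq h (gmap X h x gf al) <=
    6 / al * (phi x - phi (gm_xplus X h x gh al))
    + 3 / c * enorm (gh - g x) ^+ 2 + 3 / (2 * c) * enorm (g x - gf) ^+ 2.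
Proof.
move=> sphi Xx hc.
have H1 := descent_step _ _ _ _ gh sphi Xx hc.
have H2 := gmap_stability h x (g x) gf hc.
have h0 i : 0 <= h ord0 i by apply: le_trans (hc i); exact: ltW.
have H3 : wsq h (gmap X h x gf al) <= 3 * wsq h (gmap X h x (g x) al) +
    3 / 2 * wsq h (gmap X h x (g x) al - gmap X h x gf al).
  rewrite /wsq !mulr_sumr -big_split/=; apply: ler_sum => i _.
  rewrite !mulrA ![_ * h _ _]mulrC -!mulrA -mulrDr ler_wpM2l//.
  move: (gmap X h x (g x) al) (gmap X h x gf al) => p r.
  rewrite !mxE -subr_ge0.
  rewrite (_ : _ - _ = 2^-1 * (3 * p ord0 i - r ord0 i) ^+ 2); last by field.
  by rewrite mulr_ge0 ?sqr_ge0.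
apply: (le_trans H3).
have -> : 6 / al * (phi x - phi (gm_xplus X h x gh al)) + 3 / c * enorm (gh -
  g x) ^+ 2
    = 3 * (2 / al * (phi x - phi (gm_xplus X h x gh al)) + enorm (gh - g x) ^+
      2 / c).
  by field; rewrite !gt_eqF.
have -> : 3 / (2 * c) * enorm (g x - gf) ^+ 2 =
  3 / 2 * (enorm (g x - gf) ^+ 2 / c).
  by field; rewrite gt_eqF.
by apply: lerD; rewrite ler_wpM2l.
Qed.

End Prox.

(** * Measurability of the update operations and integration of a pathwise bound *)

Section MeasurableRows.
Context {R : realType} {d : nat} {dO : measure_display} {Omega :
  measurableType dO}.
Implicit Types (H Y Z : Omega -> 'rV[R]_d).

Lemma measurable_rowD Y Z : measurable_fun setT Y -> measurable_fun setT Z ->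
  measurable_fun setT (fun w => Y w + Z w).
Proof.
move=> /measurable_fun_rVP mY /measurable_fun_rVP mZ.
apply/measurable_fun_rVP => i; under eq_fun do rewrite mxE.
exact: measurable_funD.
Qed.

Lemma measurable_rowZ (r : Omega -> R) Y :
  measurable_fun setT r -> measurable_fun setT Y ->
  measurable_fun setT (fun w => r w *: Y w).
Proof.
move=> mr /measurable_fun_rVP mY.
apply/measurable_fun_rVP => i; under eq_fun do rewrite mxE.
exact: measurable_funM.
Qed.

Lemma measurable_rowB Y Z : measurable_fun setT Y -> measurable_fun setT Z ->
  measurable_fun setT (fun w => Y w - Z w).
Proof.
move=> mY mZ; have -> : (fun w => Y w - Z w) = (fun w => Y w + -1 *: Z w).
  by apply/funext => w; rewrite scaleN1r.
by apply: measurable_rowD => //; exact: measurable_rowZ.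
Qed.

Lemma measurable_emul Y Z : measurable_fun setT Y -> measurable_fun setT Z ->
  measurable_fun setT (fun w => emul (Y w) (Z w)).
Proof.
move=> /measurable_fun_rVP mY /measurable_fun_rVP mZ.
apply/measurable_fun_rVP => i; under eq_fun do rewrite mxE.
exact: measurable_funM.
Qed.

Lemma measurable_emax Y Z : measurable_fun setT Y -> measurable_fun setT Z ->
  measurable_fun setT (fun w => emax (Y w) (Z w)).
Proof.
move=> /measurable_fun_rVP mY /measurable_fun_rVP mZ.
apply/measurable_fun_rVP => i; under eq_fun do rewrite mxE.
exact: measurable_maxr.
Qed.

Lemma measurable_esqrt Y : measurable_fun setT Y ->
  measurable_fun setT (fun w => esqrt (Y w)).
Proof.
move=> /measurable_fun_rVP mY.
apply/measurable_fun_rVP => i; under eq_fun do rewrite mxE.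
apply: (@measurableT_comp _ _ _ _ _ _ (@Num.sqrt R)) => //.
by apply: continuous_measurable_fun; exact: sqrt_continuous.
Qed.

Lemma measurable_ediv (c : R) Y H : 0 < c -> (forall w i, c <= H w ord0 i) ->
  measurable_fun setT Y -> measurable_fun setT H ->
  measurable_fun setT (fun w => ediv (Y w) (H w)).
Proof.
move=> c0 Hc /measurable_fun_rVP mY mH.
apply/measurable_fun_rVP => i; under eq_fun do rewrite mxE.
apply: measurable_funM => //.
(* Equal on the values of [H], and now continuous on the whole space because the denominator stays
   at least [c]. *)
have -> : (fun w => (H w ord0 i)^-1) = (fun w => (c + `|H w ord0 i - c|)^-1).
  by apply/funext => w; rewrite ger0_norm ?subr_ge0// addrC subrK.
apply: (measurable_ccont (fun h : 'rV[R]_d => (c + `|h ord0 i - c|)^-1)) => //.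
move=> s h sh; apply: cvgV; first by rewrite gt_eqF// ltr_wpDr.
apply: cvgD; first exact: cvg_cst.
by apply: cvg_norm; apply: cvgB => //; exact: cvg_cst.
Qed.

Lemma measurable_wsq H Y : measurable_fun setT H -> measurable_fun setT Y ->
  measurable_fun setT (fun w => wsq (H w) (Y w)).
Proof.
move=> /measurable_fun_rVP mH /measurable_fun_rVP mY.
apply: measurable_sum => i; apply: measurable_funM => //.
exact: measurable_funX.
Qed.

Lemma measurable_sqr_enorm Y : measurable_fun setT Y ->
  measurable_fun setT (fun w => enorm (Y w) ^+ 2).
Proof.
move=> mY; apply: measurable_funX.
exact: (measurableT_comp measurable_enorm mY).
Qed.

Lemma measurable_gm_xplus (X : set 'rV[R]_d) (c al : R) H Y G :
  closed X -> convex_vset X -> X !=set0 -> 0 < c -> 0 < al ->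
  (forall w i, c <= H w ord0 i) -> measurable_fun setT H ->
  measurable_fun setT Y -> measurable_fun setT G ->
  measurable_fun setT (fun w => gm_xplus X (H w) (Y w) (G w) al).
Proof.
move=> clX cvX X0 c0 al0 Hc mH mY mG.
have E : (fun w => gm_xplus X (H w) (Y w) (G w) al) =
    (fun w => wproj X (H w) (Y w - al *: ediv (G w) (H w))).
  apply/funext => w; rewrite wproj_gm_xplus// => i.
  exact: lt_le_trans (Hc w i).
rewrite E; apply: (measurable_wproj _ c) => //.
apply: measurable_rowB => //; apply: measurable_rowZ => //.
exact: (measurable_ediv c).
Qed.

End MeasurableRows.

(** The bound is summed pathwise before integrating, so only nonnegative functions and constants
    occur and linearity holds in the extended reals. *)
Lemma expectation_sum_le {R : realType} {dO} {Omega : measurableType dO}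
    (P : probability Omega R) (T : nat) (G Dl : 'I_T -> Omega ->
      R) (C k r : R) :
  (forall t, measurable_fun setT (G t)) ->
    (forall t, measurable_fun setT (Dl t)) ->
  (forall t w, 0 <= G t w) -> (forall t w, 0 <= Dl t w) -> 0 <= C -> 0 <= k ->
  (forall w, \sum_(t < T) G t w <= C + k * \sum_(t < T) Dl t w) ->
  (forall t, 'E_P[Dl t] <= r%:E)%E ->
  (\sum_(t < T) 'E_P[G t] <= (C + k * (T%:R * r))%:E)%E.
Proof.
move=> mG mD G0 D0 C0 k0 GD Dr.
have EE X : ('E_P[X] = \int[P]_w (X w)%:E)%E by rewrite unlock.
under eq_bigr do rewrite EE.
rewrite -ge0_integral_sum//; last 2 first.
- by move=> t; exact/measurable_EFinP.
- by move=> t w _; rewrite lee_fin.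
apply: (@le_trans _ _ (\int[P]_w (C%:E + \sum_(t < T) (k%:E * (Dl t w)%:E)))%E).
  apply: ge0_le_integral => //.
  - by move=> w _; apply: sume_ge0 => t _; rewrite lee_fin.
  - by apply: emeasurable_sum => t; exact/measurable_EFinP.
  - apply: emeasurable_funD => //; apply: emeasurable_sum => t.
    by apply: emeasurable_funM => //; exact/measurable_EFinP.
  - move=> w _; rewrite sumEFin -ge0_sume_distrr; last by move=> t _;
    rewrite lee_fin.
    by rewrite sumEFin -EFinM -EFinD lee_fin.
rewrite ge0_integralD//=; last 2 first.
- by move=> w _; apply: sume_ge0 => t _; rewrite mule_ge0// lee_fin.
- apply: emeasurable_sum => t.
  by apply: emeasurable_funM => //; exact/measurable_EFinP.
rewrite integral_cst// [X in (_ * X)%E]probability_setT mule1 EFinD leeD2l//.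
rewrite ge0_integral_sum//; last 2 first.
- move=> t; by apply: emeasurable_funM => //; exact/measurable_EFinP.
- by move=> t w _; rewrite mule_ge0// lee_fin.
apply: (@le_trans _ _ (\sum_(t < T) (k * r)%:E)%E).
  apply: lee_sum => t _; rewrite ge0_integralZl_EFin//.
  - by rewrite EFinM lee_wpmul2l ?lee_fin// -EE.
  - by move=> w _; rewrite lee_fin.
  - exact/measurable_EFinP.
rewrite sumEFin lee_fin sumr_const card_ord -[leLHS]mulr_natl.
by rewrite mulrCA.
Qed.

(** * The convergence bound *)

Theorem theorem2
  (R : realType) (d T : nat)
  (* sample space of xi and its law *)
  (dX : measure_display) (Xi : measurableType dX) (Q : probability Xi R)
  (* f(x; xi) *)
  (F : Xi -> 'rV[R]_d -> R)
  (* underlying probability space *)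
  (dO : measure_display) (Omega : measurableType dO) (P : probability Omega R)
  (* Lebesgue measure on R^d *)
  (lam : {measure set 'rV[R]_d -> \bar R})
  (* constraint set *)
  (X : set 'rV[R]_d)
  (* random samples xi_t and random directions u_t *)
  (xi : nat -> Omega -> Xi) (u : nat -> Omega -> 'rV[R]_d)
  (* ZO-AdaMM iterates *)
  (x m v vhat ghat : nat -> Omega -> 'rV[R]_d)
  (x1 vhat0 : 'rV[R]_d)
  (beta1 : nat -> R)
  (Lg eta c alpha beta2 mu Df : R) :
  (0 < d)%N -> (0 < T)%N ->
  is_lebesgue_rV lam ->
  (* f(.;xi) differentiable, f(x) = E_xi[f(x;xi)] well defined *)
  (forall s y, differentiable (F s) y) ->
  (forall y, Q.-integrable setT (fun s => (F s y)%:E)) ->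
  (* (A1) L_g-Lipschitz gradient *)
  (forall s y z, enorm (grad (F s) y - grad (F s) z) <= Lg * enorm (y - z)) ->
  (* (A2) bounded gradient in sup norm *)
  (forall s y i, `|grad (F s) y ord0 i| <= eta) ->
  (* X closed convex *)
  closed X -> convex_vset X ->
  (* randomness: xi_t i.i.d. with law Q, u_t i.i.d. uniform on the sphere,
     all mutually independent *)
  (forall t, measurable_fun setT (xi t)) ->
  (forall t, measurable_fun setT (u t)) ->
  (forall t, (1 <= t <= T)%N -> forall A, measurable A -> P (xi t @^-1` A) = Q A) ->
  (forall t, (1 <= t <= T)%N -> uniform_sphere_rv P lam (u t)) ->
  (forall t, (1 <= t <= T)%N -> indep2 P (xi t) (u t)) ->
  mutual_indep P (fun (i : 'I_T) w => (xi i.+1 w, u i.+1 w)) ->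
  (* parameters *)
  0 <= Lg -> 0 < c -> 0 < alpha -> alpha * Lg <= c ->
  0 < beta2 <= 1 ->
  (forall t, beta1 t = 0) ->
  mu = (Num.sqrt (T%:R * d%:R))^-1 ->
  (forall i, c <= Num.sqrt (vhat0 ord0 i)) ->
  X x1 ->
  (* ZO-AdaMM *)
  (forall w, x 1%N w = x1) ->
  (forall w, m 0%N w = 0) -> (forall w, v 0%N w = 0) ->
  (forall w, vhat 0%N w = vhat0) ->
  (forall t w, (1 <= t <= T)%N ->
     ghat t w = (d%:R / mu * (F (xi t w) (x t w + mu *: u t w)
                              - F (xi t w) (x t w))) *: u t w) ->
  (forall t w, (1 <= t <= T)%N ->
     m t w = beta1 t *: m t.-1 w + (1 - beta1 t) *: ghat t w) ->
  (forall t w, (1 <= t <= T)%N ->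
     v t w = beta2 *: v t.-1 w + (1 - beta2) *: emul (ghat t w) (ghat t w)) ->
  (forall t w, (1 <= t <= T)%N -> vhat t w = emax (vhat t.-1 w) (v t w)) ->
  (forall t w, (1 <= t <= T)%N ->
     x t.+1 w = wproj X (esqrt (vhat t w))
                  (x t w - alpha *: ediv (m t w) (esqrt (vhat t w)))) ->
  (* f, f_mu and the initial gap *)
  let f := fun y : 'rV[R]_d => fine ('E_Q[fun s => F s y])%E in
  let fmu := fun y : 'rV[R]_d =>
    fine (\int[lam]_(w in unit_ball) (f (y + mu *: w))%:E)%E
      / fine (lam unit_ball) in
  (forall y, fmu x1 - fmu y <= Df) ->
  let Gsq := fun t w =>
    enorm (emul (esqrt (esqrt (vhat t w)))
      (gmap X (esqrt (vhat t w)) (x t w) (grad f (x t w)) alpha)) ^+ 2 in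
  let M := (\big[maxe/0%E]_(t < T)
      'E_P[fun w => (enorm (ghat t.+1 w - grad fmu (x t.+1 w)) ^+ 2)%R])%E in
  ((T%:R)^-1%:E * \sum_(t < T) 'E_P[Gsq t.+1] <=
     (6 * Df / (alpha * T%:R) + 3 * Lg ^+ 2 * d%:R / (4 * c * T%:R))%:E
     + (6 * eta ^+ 2 / (c ^+ 4 * T%:R))%:E * (M + (d%:R * eta ^+ 2)%:E)
     + ((3 * c + 9) / c)%:E * M)%E.
Proof.
move=> d0 T0 lamP dF iF LipF bF clX cvX mxi mu_ _ _ _ _ Lg0 c0 al0 alL b201 b10
  muE hv0 Xx1 xE1 m0 v0 vh0 ghE mE vE vhE xE f fmu Dfle.
pose Gsq t w := enorm (emul (esqrt (esqrt (vhat t w)))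
  (gmap X (esqrt (vhat t w)) (x t w) (grad f (x t w)) alpha)) ^+ 2.
pose M := (\big[maxe/0%E]_(t < T)
  'E_P[fun w => (enorm (ghat t.+1 w - grad fmu (x t.+1 w)) ^+ 2)%R])%E.
pose K := 3 * Lg ^+ 2 * d%:R / (4 * c * T%:R).
change (is_true ((T%:R)^-1%:E * \sum_(t < T) 'E_P[Gsq t.+1] <=
  (6 * Df / (alpha * T%:R) + K)%:E
  + (6 * eta ^+ 2 / (c ^+ 4 * T%:R))%:E * (M + (d%:R * eta ^+ 2)%:E)
  + ((3 * c + 9) / c)%:E * M)%E).
have TR0 : (0 : R) < T%:R by rewrite ltr0n.
have dR0 : (0 : R) < d%:R by rewrite ltr0n.
have mu0 : 0 < mu by rewrite muE invr_gt0 sqrtr_gt0 mulr_gt0.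
have mu2 : mu ^+ 2 = (T%:R * d%:R)^-1.
  by rewrite muE exprVn sqr_sqrtr// ltW// mulr_gt0.
have X0 : X !=set0 by exists x1.
have mF y : measurable_fun setT (F ^~ y).
  exact/measurable_EFinP/(measurable_int Q (iF y)).
have sF s : smooth_with Lg (F s) (grad (F s)).
  exact: differentiable_smooth.
have Q1 : 1 * fine (Q setT) = 1 by rewrite probability_setT mul1r.
have Qfin : (Q setT < +oo)%E by rewrite probability_setT ltry.
(* The uniform bound [eta] makes the gradient coordinates integrable; measurability comes from
   difference quotients. *)
have igF y : rintble Q setT (fun s => grad (F s) y).
  move=> i; apply: measurable_bounded_integrable => //.
    exact: (smooth_grad_measurable Lg F (fun s => grad (F s))).
  exists eta; split; [exact: num_real|move=> r etar s _ /=].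
  exact: le_trans (bF s y i) (ltW etar).
pose gf y := ravg Q setT 1 (fun s => grad (F s) y).
(* Writing [f], and later [fmu], as averages yields their smoothness with constant [Lg] and their
   gradients as averaged gradients. *)
have fE : f = (fun y => avg Q setT 1 (F ^~ y)).
  by apply/funext => y; rewrite /f /avg mul1r unlock.
have sf : smooth_with Lg f gf.
  rewrite fE; apply: (avg_smooth Q setT 1 _ _ _ _ Lg F (fun s => grad (F s)))
    => //.
have Lipf : forall y z, enorm (gf y - gf z) <= Lg * enorm (y - z).
  by apply: (ravg_lipschitz Q setT 1 _ _ _ _ Lg (fun s => grad (F s))).
have gradf : grad f = gf := smooth_grad _ _ _ sf.
pose k := (fine (lam unit_ball))^-1.
pose gmu y := ravg lam unit_ball k (fun w => gf (y + mu *: w)).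
have fmuE : fmu = (fun y => avg lam unit_ball k (fun w => f (y + mu *: w))).
  by apply/funext => y; rewrite /fmu /avg mulrC.
have smu : smooth_with Lg fmu gmu.
  rewrite fmuE; exact: (ball_avg_smooth lam d0 lamP Lg mu f gf Lg0 (ltW mu0)
    sf Lipf).
have Lipmu : forall y z, enorm (gmu y - gmu z) <= Lg * enorm (y - z).
  exact: (ball_avg_lipschitz lam d0 lamP Lg mu gf Lg0 (ltW mu0) Lipf).
have gradmu : grad fmu = gmu := smooth_grad _ _ _ smu.
(* The factor [mu ^+ 2 = 1 / (T * d)] meets the bound [d ^+ 2 / 2] on the squared mean norm. *)
have bias y : enorm (gmu y - gf y) ^+ 2 <= Lg ^+ 2 * d%:R / (2 * T%:R).
  have B := ball_avg_bias lam d0 lamP Lg mu gf Lg0 (ltW mu0) Lipf y.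
  have B2 := bavg_enorm_sqr lam d0 lamP.
  rewrite -/k -/(gmu y) in B B2; set b := avg _ _ _ _ in B B2.
  clearbody b.
  have : enorm (gmu y - gf y) ^+ 2 <= (Lg * mu * b) ^+ 2.
    by rewrite ler_pXn2r ?nnegrE ?enorm_ge0// (le_trans _ B)// enorm_ge0.
  move=> /le_trans; apply.
  rewrite !exprMn mu2; apply: (@le_trans _ _
    (Lg ^+ 2 * (T%:R * d%:R)^-1 * (d%:R ^+ 2 / 2))).
    apply: ler_wpM2l; last exact: B2.
    by apply: mulr_ge0; [exact: sqr_ge0|rewrite invr_ge0 ltW ?mulr_gt0].
  by rewrite le_eqVlt; apply/orP; left; apply/eqP; field; rewrite !gt_eqF.
have mghat t : (1 <= t <= T)%N -> measurable_fun setT (x t) ->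
    measurable_fun setT (ghat t).
  move=> tT mx.
  have -> : ghat t = (fun w => (d%:R / mu * (F (xi t w) (x t w + mu *: u t w)
                              - F (xi t w) (x t w))) *: u t w).
    by apply/funext => w; rewrite ghE.
  apply: measurable_rowZ => //; apply: measurable_funM => //.
  have cF s : ccont (F s) := smooth_ccont _ _ _ (sF s).
  apply: measurable_funB; apply: measurable_caratheodory => //.
  by apply: measurable_rowD => //; exact: measurable_rowZ.
have mEg t w : (1 <= t <= T)%N -> m t w = ghat t w.
  by move=> tT; rewrite mE// b10 scale0r add0r subr0 scale1r.
have hstep t : (1 <= t <= T)%N -> forall w,
    (forall i, c <= Num.sqrt (vhat t.-1 w ord0 i)) ->
    forall i, c <= Num.sqrt (vhat t w ord0 i).
  move=> tT w H i; apply: (le_trans (H i)); rewrite (vhE t)//.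
  by apply: ler_wsqrtr; rewrite mxE le_max lexx.
(* The iterate of index [t.+1] is paired with [vhat] of index [t], the last quantities built from
   the first [t] samples; [t = 0] is the initial data. The lower bound on [vhat] persists because
   [emax] never decreases it. *)
have inv t : (t <= T)%N ->
  [/\ forall w, X (x t.+1 w), measurable_fun setT (x t.+1),
      measurable_fun setT (v t), measurable_fun setT (vhat t) &
      forall w i, c <= Num.sqrt (vhat t w ord0 i)].
  elim: t => [_|t IH tT].
    split.
    - by move=> w; rewrite xE1.
    - by rewrite (_ : x 1%N = cst x1)//; apply/funext => w; rewrite xE1.
    - by rewrite (_ : v 0%N = cst 0)//; apply/funext => w; rewrite v0.
    - by rewrite (_ : vhat 0%N = cst vhat0)//; apply/funext => w; rewrite vh0.
    - by move=> w i; rewrite vh0.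
  have [Xx mx mv mvh hc] := IH (ltnW tT).
  have t1T : (1 <= t.+1 <= T)%N by [].
  have mg := mghat _ t1T mx.
  have hc' : forall w i, c <= Num.sqrt (vhat t.+1 w ord0 i).
    by move=> w; apply: hstep => //; exact: hc.
  have hc2 w i : c <= esqrt (vhat t.+1 w) ord0 i by rewrite mxE.
  have mv' : measurable_fun setT (v t.+1).
    rewrite (_ : v t.+1 = fun w => beta2 *: v t w +
       (1 - beta2) *: emul (ghat t.+1 w) (ghat t.+1 w)).
      apply: measurable_rowD; apply: measurable_rowZ => //.
      exact: measurable_emul.
    by apply/funext => w; rewrite vE.
  have mvh' : measurable_fun setT (vhat t.+1).
    rewrite (_ : vhat t.+1 = fun w => emax (vhat t w) (v t.+1 w)).
      exact: measurable_emax.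
    by apply/funext => w; rewrite vhE.
  split=> //.
    by move=> w; rewrite xE//; have [] := wproj_minimizes _ _
      (x t.+1 w - alpha *: ediv (m t.+1 w) (esqrt (vhat t.+1 w))) _ clX X0 c0
        (hc2 w).
  rewrite (_ : x t.+2 = fun w => gm_xplus X (esqrt (vhat t.+1 w)) (x t.+1 w)
      (ghat t.+1 w) alpha).
    apply: (measurable_gm_xplus X c) => //.
    exact: measurable_esqrt.
  apply/funext => w; rewrite xE// mEg// wproj_gm_xplus// => i.
  exact: lt_le_trans (hc2 w i).
have inv1 (t : 'I_T) : [/\ forall w, X (x t.+1 w), measurable_fun setT (x t.+1),
    measurable_fun setT (vhat t.+1) &
    forall w i, c <= esqrt (vhat t.+1 w) ord0 i].
  have [Xx mx _ _ _] := inv t (ltnW (ltn_ord t)).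
  have [_ _ _ mvh hc] := inv t.+1 (ltn_ord t).
  by split=> // w i; rewrite mxE.
pose Dl (t : 'I_T) w := enorm (ghat t.+1 w - grad fmu (x t.+1 w)) ^+ 2.
have GE (t : 'I_T) w : Gsq t.+1 w = wsq (esqrt (vhat t.+1 w))
    (gmap X (esqrt (vhat t.+1 w)) (x t.+1 w) (gf (x t.+1 w)) alpha).
  have [_ _ _ hc] := inv1 t.
  rewrite /Gsq gradf sqr_enorm_esqrt// => i.
  exact: le_trans (ltW c0) (hc w i).
have mgrad (g : 'rV[R]_d -> 'rV[R]_d) (Y : Omega -> 'rV[R]_d) :
    (forall y z, enorm (g y - g z) <= Lg * enorm (y - z)) ->
    measurable_fun setT Y -> measurable_fun setT (fun w => g (Y w)).
  move=> Lipg mY; apply/measurable_fun_rVP => i.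
  apply: (measurable_ccont (fun y => g y ord0 i)) => //.
  exact: lipschitz_ccont Lipg.
have K0 : 0 <= K.
  by rewrite divr_ge0 ?mulr_ge0 ?sqr_ge0// ltW.
have Df0 : 0 <= Df by have := Dfle x1; rewrite subrr.
have step (t : 'I_T) w : Gsq t.+1 w <=
    6 / alpha * (fmu (x t.+1 w) - fmu (x t.+2 w)) + 3 / c * Dl t w + K.
  have [Xx _ _ hc] := inv1 t.
  have t1T : (1 <= t.+1 <= T)%N by rewrite /= ltn_ord.
  have xz : x t.+2 w = gm_xplus X (esqrt (vhat t.+1 w)) (x t.+1 w)
      (ghat t.+1 w) alpha.
    rewrite xE// mEg// wproj_gm_xplus// => i; exact: lt_le_trans (hc w i).
  rewrite GE xz /Dl gradmu.
  apply: (le_trans (gmap_sqr_le _ _ clX cvX X0 c0 _ _ al0 alL _ _ _ _ (ghat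
    t.+1 w)
    (gf (x t.+1 w)) smu (Xx w) (hc w))).
  rewrite lerD2l.
  (* The bias contributes [3 / (2 * c)] times [Lg ^+ 2 * d / (2 * T)], which is [K]. *)
  apply: (le_trans (ler_wpM2l _ (bias (x t.+1 w)))).
    by rewrite divr_ge0// ltW// mulr_gt0.
  by rewrite le_eqVlt /K; apply/orP; left; apply/eqP; field; rewrite !gt_eqF.
clearbody K.
have total w : \sum_(t < T) Gsq t.+1 w <=
    (6 / alpha * Df + T%:R * K) + 3 / c * \sum_(t < T) Dl t w.
  apply: (le_trans (ler_sum _ (fun t _ => step t w))).
  (* What remains is [fmu x1] minus [fmu] at the random last iterate; [Df] bounds this on every path
     because the gap hypothesis holds at every point. *)
  have tele n : \sum_(t < n) (fmu (x t.+1 w) - fmu (x t.+2 w)) =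
      fmu (x 1%N w) - fmu (x n.+1 w).
    elim: n => [|n IH]; first by rewrite big_ord0 subrr.
    by rewrite big_ord_recr/= IH; ring.
  rewrite !big_split/= -!mulr_sumr sumr_const card_ord -[K *+ T]mulr_natl.
  rewrite tele xE1 [leRHS]addrAC lerD2r lerD2r.
  by apply: ler_wpM2l => //; rewrite divr_ge0// ltW.
have M0 : (0 <= M)%E by rewrite /M bigmax_idl le_max lexx.
have DM (t : 'I_T) : ('E_P[Dl t] <= M)%E.
  exact: (@le_bigmax _ _ _ 0%E (fun t : 'I_T => 'E_P[Dl t])%E).
have e0 : 0 < (3 * c + 9) / c by rewrite divr_gt0// addr_gt0// mulr_gt0.
have A0 : 0 <= 6 * eta ^+ 2 / (c ^+ 4 * T%:R).
  by apply: divr_ge0; apply: mulr_ge0 => //;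
    [exact: sqr_ge0|rewrite exprn_ge0// ltW].
have C0 : 0 <= 6 * Df / (alpha * T%:R) + K.
  by rewrite addr_ge0// divr_ge0 ?mulr_ge0// ltW.
have dE0 : (0 <= (d%:R * eta ^+ 2)%:E)%E by rewrite lee_fin mulr_ge0 ?sqr_ge0.
(* [M] is an extended real. If it is infinite, its strictly positive coefficient makes the
   right-hand side infinite; the value [-oo] contradicts [M0]. *)
clearbody M; case: M M0 DM => [r| |] M0 DM; last 2 first.
- have -> : (((3 * c + 9) / c)%:E * +oo = +oo)%E by rewrite gt0_muley ?lte_fin.
  rewrite addey ?leey// gt_eqF// (lt_le_trans (ltNye 0))//.
  by rewrite adde_ge0// mule_ge0// adde_ge0.
- by move: M0; rewrite leNgt ltNye.
have CT0 : 0 <= 6 / alpha * Df + T%:R * K.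
  by rewrite addr_ge0// mulr_ge0// ?divr_ge0// ltW.
have c30 : 0 <= 3 / c by rewrite divr_ge0// ltW.
have mDl t : measurable_fun setT (Dl t).
  have [_ mx _ _] := inv1 t.
  apply: measurable_sqr_enorm; apply: measurable_rowB.
    by apply: mghat; rewrite // ltn_ord.
  by rewrite gradmu; exact: mgrad.
have mG (t : 'I_T) : measurable_fun setT (Gsq t.+1).
  have [_ mx mvh hc] := inv1 t.
  have -> : Gsq t.+1 = fun w => wsq (esqrt (vhat t.+1 w))
      (gmap X (esqrt (vhat t.+1 w)) (x t.+1 w) (gf (x t.+1 w)) alpha).
    by apply/funext => w; exact: GE.
  have mh := measurable_esqrt _ mvh.
  apply: measurable_wsq => //; apply: measurable_rowZ => //.
  apply: measurable_rowB => //; apply: (measurable_gm_xplus X c) => //.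
  exact: mgrad.
have := expectation_sum_le P T (fun t => Gsq t.+1) Dl _ _ r mG mDl
  (fun t w => sqr_ge0 _) (fun t w => sqr_ge0 _) CT0 c30 total DM.
move=> /(lee_wpmul2l (_ : 0 <= (T%:R^-1)%:E)%E).
rewrite lee_fin invr_ge0 ler0n => /(_ isT) /le_trans; apply.
rewrite -!(EFinD, EFinM) lee_fin.
rewrite lee_fin in M0.
have -> : T%:R^-1 * (6 / alpha * Df + T%:R * K + 3 / c * (T%:R * r)) =
    6 * Df / (alpha * T%:R) + K + 3 / c * r.
  by field; rewrite !gt_eqF.
(* The remaining room: the [eta] term is nonnegative, and the variance coefficient [3 / c] obtained
   is below [(3 * c + 9) / c]. *)
have A1 : 0 <= 6 * eta ^+ 2 / (c ^+ 4 * T%:R) * (r + d%:R * eta ^+ 2).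
  by apply: mulr_ge0 => //; apply: addr_ge0.
have A2 : 3 / c * r <= (3 * c + 9) / c * r.
  by rewrite ler_wpM2r// ler_wpM2r ?invr_ge0 ?(ltW c0)//; lra.
by move: A1 A2; lra.
Qed.
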